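(* Let $X$ be a pointed metric space such that $X^\#$ has the approximation property. Then, for any Banach space $E$ over $\mathbb{K}$, the space of all Lipschitz compact operators from $X$ to $E^*$ (with the norm $\mathrm{Lip}$) is isometrically isomorphic to $X^\#\widehat{\circledast}_{\pi'}E^*$.
   Context: $\mathbb{K}$ is $\mathbb{R}$ or $\mathbb{C}$. A pointed metric space $X$ is a metric space (with metric $d$) with a distinguished base point $0$. For a pointed metric space $X$ and a Banach space $F$, $\mathrm{Lip}_0(X,F)$ is the Banach space of all Lipschitz maps $f\colon X\to F$ with $f(0)=0$, normed by the least Lipschitz constant $\mathrm{Lip}(f)$; $X^\#=\mathrm{Lip}_0(X,\mathbb{K})$. $E^*$ is the topological dual of $E$ and $\langle\phi,e\rangle=\phi(e)$; $V'$ denotes the algebraic dual of a vector space $V$. For $x,y\in X$ and $e\in E$, $\delta_{(x,y)}\boxtimes e\in \mathrm{Lip}_0(X,E^* )'$ is the linear functional $f\mapsto\langle f(x)-f(y),e\rangle$. The Lipschitz tensor product $X\boxtimes E$ is the linear subspace of $\mathrm{Lip}_0(X,E^* )'$ spanned by all the functionals $\delta_{(x,y)}\boxtimes e$ with $x,y\in X$, $e\in E$. Every $u\in X\boxtimes E$ can be written (non-uniquely) as $u=\sum_{i=1}^n\delta_{(x_i,y_i)}\boxtimes e_i$. The Lipschitz projective norm on $X\boxtimes E$ is $\pi(u)=\inf\left\{\sum_{i=1}^n d(x_i,y_i)\|e_i\|\colon u=\sum_{i=1}^n\delta_{(x_i,y_i)}\boxtimes e_i\right\}$, the infimum being over all representations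 of $u$. For $g\in X^\#$ and $\phi\in E^*$, $g\boxtimes\phi\in(X\boxtimes E)'$ is the (well-defined) linear functional $(g\boxtimes\phi)\left(\sum_{i=1}^n \delta_{(x_i,y_i)}\boxtimes e_i\right)=\sum_{i=1}^n(g(x_i)-g(y_i))\langle\phi,e_i\rangle$. The space $X^\#\circledast E^*$ is the linear subspace of $(X\boxtimes E)'$ spanned by $\{g\boxtimes\phi\colon g\in X^\#,\ \phi\in E^*\}$. The norm $\pi'$ on $X^\#\circledast E^*$ is the restriction of the dual norm of $(X\boxtimes E,\pi)^*$: $\pi'(u^* )=\sup\{|u^*(u)|\colon u\in X\boxtimes E,\ \pi(u)\leq 1\}$. $X^\#\widehat{\circledast}_{\pi'}E^*$ is the completion of $X^\#\circledast E^*$ with the norm $\pi'$. A map $f\in\mathrm{Lip}_0(X,F)$ into a Banach space $F$ is Lipschitz compact if $\{(f(x)-f(y))/d(x,y)\colon x,y\in X,\ x\neq y\}$ is relatively compact in $F$. A Banach space $Z$ has the approximation property if for every compact set $C\subset Z$ and every $\eta>0$ there is a finite-rank bounded linear operator $T\colon Z\to Z$ with $\|Tz-z\|<\eta$ for every $z\in C$. *)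

(* Defs.v *)
From HB Require Import structures.
From mathcomp Require Import all_boot all_order all_algebra.
From mathcomp Require Import ring_quotient.
From mathcomp Require Import complex.
From mathcomp Require Import boolp classical_sets functions reals topology.
From mathcomp Require Import interval_inference normedtype sequences lra.

Set Implicit Arguments.
Unset Strict Implicit.
Unset Printing Implicit Defensive.

Import Order.TTheory GRing.Theory Num.Theory.
Import numFieldNormedType.Exports.

Local Open Scope classical_set_scope.
Local Open Scope ring_scope.


(* The scalar field is R itself or its complexification R[i]. *)
Inductive scalar_kind := real_scalars | complex_scalars.

Definition scalar_field (R : realType) (k : scalar_kind) : numFieldType :=
  match k with real_scalars => R | complex_scalars => R[i] end.

Definition scalar_of (R : realType) (k : scalar_kind) : R -> scalar_field R k :=
  match k return R -> scalar_field R k with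
  | real_scalars => fun r => r
  | complex_scalars => fun r => r%:C%C
  end.

Definition scalar_re (R : realType) (k : scalar_kind) : scalar_field R k -> R :=
  match k return scalar_field R k -> R with
  | real_scalars => fun r => r
  | complex_scalars => fun z => complex.Re z
  end.

Arguments scalar_of {R k}.
Arguments scalar_re {R k}.

Section Scalar.
Variables (R : realType) (k : scalar_kind).
Local Notation K := (scalar_field R k).
Implicit Types (r s : R) (a : K).

Lemma scalar_ofK : cancel (@scalar_of R k) scalar_re.
Proof. by rewrite /scalar_of /scalar_re; case: k. Qed.

Lemma scalar_reK a : 0 <= a -> scalar_of (scalar_re a) = a.
Proof.
move: a; rewrite /scalar_of /scalar_re; case: k => //= -[x y].
by rewrite lecE /= => /andP[/eqP -> _].
Qed.

Lemma scalar_ofD r s : scalar_of (r + s) = scalar_of r + scalar_of s :> K.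
Proof. by rewrite /scalar_of; case: k => //=; rewrite rmorphD. Qed.

Lemma scalar_ofM r s : scalar_of (r * s) = scalar_of r * scalar_of s :> K.
Proof. by rewrite /scalar_of; case: k => //=; rewrite rmorphM. Qed.

Lemma scalar_of0 : scalar_of 0 = 0 :> K.
Proof. by rewrite /scalar_of; case: k. Qed.

Lemma scalar_of1 : scalar_of 1 = 1 :> K.
Proof. by rewrite /scalar_of; case: k. Qed.

Lemma ler_scalar_of r s : (scalar_of r <= scalar_of s :> K) = (r <= s).
Proof. by rewrite /scalar_of; case: k => //=; rewrite lecR. Qed.

Lemma ltr_scalar_of r s : (scalar_of r < scalar_of s :> K) = (r < s).
Proof. by rewrite /scalar_of; case: k => //=; rewrite ltcR. Qed.

(* Norms of normed spaces over [K] take their values in [K]; [rnorm] is the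
   same norm, read as a real number. *)
Definition rnorm (V : normedZmodType K) (v : V) : R := scalar_re `|v|.

Lemma rnormE (V : normedZmodType K) (v : V) : `|v| = scalar_of (rnorm v).
Proof. by rewrite scalar_reK. Qed.

Section RNorm.
Variable V : normedZmodType K.
Implicit Types v w : V.

Lemma rnorm_ge0 v : 0 <= rnorm v.
Proof. by rewrite -ler_scalar_of -rnormE scalar_of0. Qed.

Lemma rnormD v w : rnorm (v + w) <= rnorm v + rnorm w.
Proof. by rewrite -ler_scalar_of scalar_ofD -!rnormE ler_normD. Qed.

Lemma rnorm0 : rnorm (0 : V) = 0.
Proof. by rewrite /rnorm normr0 -scalar_of0 scalar_ofK. Qed.

Lemma rnorm0_eq0 v : rnorm v = 0 -> v = 0.
Proof. by move=> v0; apply: normr0_eq0; rewrite rnormE v0 scalar_of0. Qed.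

Lemma rnormN v : rnorm (- v) = rnorm v.
Proof. by rewrite /rnorm normrN. Qed.

Lemma rnormB v w : rnorm (v - w) = rnorm (w - v).
Proof. by rewrite -opprB rnormN. Qed.
End RNorm.

Lemma rnormZ (V : normedModType K) a (v : V) : rnorm (a *: v) = rnorm a * rnorm v.
Proof.
apply: (can_inj scalar_ofK).
by rewrite scalar_ofM -!rnormE normrZ.
Qed.

Lemma rnormM (a b : K) : rnorm (a * b) = rnorm a * rnorm b.
Proof. by apply: (can_inj scalar_ofK); rewrite scalar_ofM -!rnormE normrM. Qed.

Lemma rnorm_scalar_of r : 0 <= r -> rnorm (scalar_of r : K) = r.
Proof.
move=> r0; rewrite /rnorm ger0_norm ?scalar_ofK//.
by rewrite -scalar_of0 ler_scalar_of.
Qed.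

Lemma rnorm_ball (V : normedModType K) (v w : V) r :
  ball v (scalar_of r : K) w = (rnorm (v - w) < r).
Proof. by rewrite -ball_normE /ball_/= rnormE ltr_scalar_of. Qed.

End Scalar.

HB.factory Record Lmodule_isRealNormed (R : realType) (k : scalar_kind) V
    of GRing.Lmodule (scalar_field R k) V := {
  realnorm : V -> R;
  realnormD : forall x y, realnorm (x + y) <= realnorm x + realnorm y;
  realnormZ : forall (a : scalar_field R k) x, realnorm (a *: x) = rnorm a * realnorm x;
  realnorm0_eq0 : forall x, realnorm x = 0 -> x = 0
}.

HB.builders Context (R : realType) (k : scalar_kind) V
  of @Lmodule_isRealNormed R k V.

Let nrm (x : V) : scalar_field R k := scalar_of (realnorm x).

Let nrmD x y : nrm (x + y) <= nrm x + nrm y.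
Proof. by rewrite -scalar_ofD ler_scalar_of realnormD. Qed.

Let nrmZ (a : scalar_field R k) x : nrm (a *: x) = `|a| * nrm x.
Proof. by rewrite rnormE -scalar_ofM /nrm realnormZ. Qed.

Let nrm0 x : nrm x = 0 -> x = 0.
Proof.
move=> /(congr1 scalar_re); rewrite scalar_ofK => xz.
apply: realnorm0_eq0; rewrite xz -[in LHS](@scalar_of0 R k).
exact: scalar_ofK.
Qed.

HB.instance Definition _ :=
  @Lmodule_isNormed.Build (scalar_field R k) V nrm nrmD nrmZ nrm0.

HB.end.

Section Submodule.
Variables (K : numFieldType) (V : lmodType K) (S : submodClosed V).

Record submodule := Submodule { submodule_val : V; submoduleP : submodule_val \in S }.

HB.instance Definition _ := [isSub for submodule_val].
HB.instance Definition _ := [Choice of submodule by <:].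
HB.instance Definition _ := [SubChoice_isSubLmodule of submodule by <:].

Lemma submodule_val_is_linear : linear submodule_val.
Proof. exact: (linearP (\val : submodule -> V)). Qed.

HB.instance Definition _ := GRing.isLinear.Build K submodule V _ submodule_val
  submodule_val_is_linear.
End Submodule.

Section Span.
Variables (K : numFieldType) (V : lmodType K) (A : set V).

Definition lin_span_pred : {pred V} :=
  [pred v | `[< exists (n : nat) (a : 'I_n -> K) (w : 'I_n -> V),
    (forall i, A (w i)) /\ v = \sum_(i < n) a i *: w i >]].

Lemma lin_span_submod_closed : submod_closed lin_span_pred.
Proof.
split.
  apply/asboolP.
  exists 0%N, (fun=> 0), (fun=> 0).
  by split=> [[]//|]; rewrite big_ord0.
move=> c u v /asboolP[n [a [w [Aw ->]]]] /asboolP[m [b [z [Az ->]]]].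
apply/asboolP; exists (n + m)%N.
exists (fun i => match fintype.split i with inl j => c * a j | inr j => b j end).
exists (fun i => match fintype.split i with inl j => w j | inr j => z j end).
split=> [i|]; first by case: fintype.split.
rewrite big_split_ord/= scaler_sumr; congr (_ + _); apply: eq_bigr => i _.
  by rewrite (unsplitK (inl i)) scalerA.
by rewrite (unsplitK (inr i)).
Qed.

HB.instance Definition _ :=
  GRing.isSubmodClosed.Build K V lin_span_pred lin_span_submod_closed.

Definition lin_span := submodule lin_span_pred.

HB.instance Definition _ := GRing.Lmodule.on lin_span.

Lemma mem_lin_span v : A v -> v \in lin_span_pred.
Proof.
move=> Av; apply/asboolP; exists 1%N.
exists (fun=> 1), (fun=> v).
by split=> //; rewrite big_ord1 scale1r.
Qed.
End Span.

Section AlgebraicDual.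
Variables (K : numFieldType) (V : lmodType K).

Definition alg_dual_pred : {pred V -> K^o} :=
  [pred f : V -> K^o | `[< linear f >]].

Lemma alg_dual_submod_closed : submod_closed alg_dual_pred.
Proof.
split; first by apply/asboolP => a u v; rewrite scaler0 addr0.
move=> c f g /asboolP lf /asboolP lg; apply/asboolP => a u v.
by rewrite /= !fctE lf lg !scalerDr addrACA !scalerA mulrC.
Qed.

HB.instance Definition _ :=
  GRing.isSubmodClosed.Build K (V -> K^o) alg_dual_pred alg_dual_submod_closed.

Definition alg_dual := submodule alg_dual_pred.

HB.instance Definition _ := GRing.Lmodule.on alg_dual.
End AlgebraicDual.

Definition alg_dual_fun (K : numFieldType) (V : lmodType K) (u : alg_dual V) :
  V -> K^o := submodule_val u.
Coercion alg_dual_fun : alg_dual >-> Funclass.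

Section AlgebraicDualTheory.
Variables (K : numFieldType) (V : lmodType K).

Lemma alg_dualD (u v : alg_dual V) x : alg_dual_fun (u + v) x = u x + v x.
Proof. by rewrite /alg_dual_fun raddfD. Qed.

Lemma alg_dualZ a (u : alg_dual V) x : alg_dual_fun (a *: u) x = a *: u x.
Proof. by rewrite /alg_dual_fun linearZ. Qed.

Lemma alg_dual_linear (u : alg_dual V) : linear u.
Proof. by have /asboolP := submoduleP u. Qed.

HB.instance Definition _ (u : alg_dual V) :=
  GRing.isLinear.Build K V K^o _ (alg_dual_fun u) (alg_dual_linear u).
End AlgebraicDualTheory.

Section SupNorm.
Variables (R : realType) (k : scalar_kind) (T : Type) (B : set T).
Local Notation K := (scalar_field R k).
Implicit Types f g : T -> K^o.

Definition supnorm f : R := sup [set rnorm (f t) | t in B].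

Definition bounded_on f := exists C : R, forall t, B t -> rnorm (f t) <= C.

Hypothesis B0 : B !=set0.

Lemma supnorm_has_sup f : bounded_on f -> has_sup [set rnorm (f t) | t in B].
Proof.
move=> [C fC]; split; first by have [t Bt] := B0; exists (rnorm (f t)), t.
by exists C => _ [t Bt <-]; exact: fC.
Qed.

Lemma supnorm_ge f t : bounded_on f -> B t -> rnorm (f t) <= supnorm f.
Proof. by move=> /supnorm_has_sup fb Bt; apply: sup_upper_bound => //; exists t. Qed.

Lemma supnorm_le f C : (forall t, B t -> rnorm (f t) <= C) -> supnorm f <= C.
Proof.
move=> fC; apply: ge_sup => [|_ [t Bt <-]]; last exact: fC.
by have [t Bt] := B0; exists (rnorm (f t)), t.
Qed.

Lemma supnorm_ge0 f : bounded_on f -> 0 <= supnorm f.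
Proof.
by have [t Bt] := B0 => /supnorm_ge/(_ Bt); apply: le_trans; exact: rnorm_ge0.
Qed.

Lemma supnormD f g : bounded_on f -> bounded_on g ->
  supnorm (f + g) <= supnorm f + supnorm g.
Proof.
move=> fb gb; apply: supnorm_le => t Bt.
by rewrite (le_trans (rnormD _ _))// lerD// supnorm_ge.
Qed.

Lemma supnormZ (a : K) f : bounded_on f -> supnorm (a *: f) = rnorm a * supnorm f.
Proof.
have le_Z (b : K) g : bounded_on g -> supnorm (b *: g) <= rnorm b * supnorm g.
  move=> gb; apply: supnorm_le => t Bt.
  by rewrite (rnormZ b (g t)) ler_wpM2l ?rnorm_ge0// supnorm_ge.
move=> fb; apply/eqP; rewrite eq_le le_Z//=.
have [->|a0] := eqVneq a 0.
  rewrite (rnorm0 K) mul0r supnorm_ge0//.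
  exists 0 => t _; rewrite (_ : _ t = 0) ?rnorm0//.
  by rewrite fctE/= scale0r.
have afb : bounded_on (a *: f).
  have [C fC] := fb; exists (rnorm a * C) => t Bt.
  by rewrite (rnormZ a (f t)) ler_wpM2l ?rnorm_ge0// fC.
have := le_Z a^-1 _ afb; rewrite scalerA mulVf// scale1r => h.
rewrite (le_trans (ler_wpM2l _ h)) ?rnorm_ge0//.
by rewrite mulrA -rnormM divff// [rnorm 1](_ : _ = 1) ?mul1r// -(scalar_of1 R k) rnorm_scalar_of.
Qed.
End SupNorm.

Section TopDual.
Variables (R : realType) (k : scalar_kind).
Local Notation K := (scalar_field R k).
Variable E : normedModType K.

Definition top_dual_pred : {pred alg_dual E} :=
  [pred f : alg_dual E | `[< continuous (f : E -> K^o) >]].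

Lemma top_dual_submod_closed : submod_closed top_dual_pred.
Proof.
split; first by apply/asboolP => x; exact: cst_continuous.
move=> a f g /asboolP cf /asboolP cg; apply/asboolP.
rewrite (_ : alg_dual_fun _ = (a *: alg_dual_fun f) \+ alg_dual_fun g); last first.
  by apply/funext => e; rewrite alg_dualD alg_dualZ.
by move=> x; apply: (cvgD (cvgZl_tmp (cf x)) (cg x)).
Qed.

HB.instance Definition _ :=
  GRing.isSubmodClosed.Build K (alg_dual E) top_dual_pred top_dual_submod_closed.

Definition top_dual := submodule top_dual_pred.

HB.instance Definition _ := GRing.Lmodule.on top_dual.
End TopDual.

Definition top_dual_fun (R : realType) (k : scalar_kind)
  (E : normedModType (scalar_field R k)) (phi : top_dual E) : E -> (scalar_field R k)^o :=
  (submodule_val phi : alg_dual E).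
Coercion top_dual_fun : top_dual >-> Funclass.

Section DualNorm.
Variables (R : realType) (k : scalar_kind).
Local Notation K := (scalar_field R k).
Variable E : normedModType K.
Implicit Types phi psi : top_dual E.

HB.instance Definition _ phi :=
  GRing.isLinear.Build K E K^o _ (top_dual_fun phi) (@alg_dual_linear K E (submodule_val phi)).

Lemma top_dualD phi psi e : top_dual_fun (phi + psi) e = phi e + psi e.
Proof. by rewrite /top_dual_fun raddfD alg_dualD. Qed.

Lemma top_dualZ (a : K) phi e : top_dual_fun (a *: phi) e = a *: phi e.
Proof. by rewrite /top_dual_fun linearZ alg_dualZ. Qed.

Lemma top_dual_continuous phi : continuous phi.
Proof. by have /asboolP := submoduleP phi. Qed.

Lemma top_dual_bounded phi :
  exists2 C : R, 0 <= C & forall e, rnorm (phi e) <= C * rnorm e.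
Proof.
have /linear_bounded_continuous/linear_boundedP/pinfty_ex_gt0[r r0 h] :=
  @top_dual_continuous phi.
have rE := scalar_reK (ltW r0).
exists (scalar_re r) => [|e]; first by rewrite -(ler_scalar_of k) rE scalar_of0 ltW.
by rewrite -(ler_scalar_of k) scalar_ofM rE -!rnormE; exact: h.
Qed.

Definition unit_ball : set E := [set e | rnorm e <= 1].

Definition top_dual_norm phi : R := supnorm unit_ball phi.

Lemma unit_ball0 : unit_ball !=set0.
Proof. by exists 0; rewrite /unit_ball/= rnorm0. Qed.

Lemma top_dual_bounded_on phi : bounded_on unit_ball phi.
Proof.
have [C C0 hC] := top_dual_bounded phi; exists C => e e1.
by rewrite (le_trans (hC e))// ler_piMr.
Qed.

Lemma top_dual_normP phi e : rnorm (phi e) <= top_dual_norm phi * rnorm e.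
Proof.
have [/rnorm0_eq0->|e0] := eqVneq (rnorm e) 0.
  by rewrite linear0 !rnorm0 mulr0.
have ep : 0 < rnorm e by rewrite lt_neqAle eq_sym e0 rnorm_ge0.
rewrite -ler_pdivrMr//.
have -> : rnorm (phi e) / rnorm e = rnorm (phi ((scalar_of (rnorm e)^-1 : K) *: e)).
  by rewrite linearZ/= rnormM rnorm_scalar_of ?invr_ge0 ?rnorm_ge0// mulrC.
apply: supnorm_ge; [exact: unit_ball0|exact: top_dual_bounded_on|].
by rewrite /unit_ball/= rnormZ rnorm_scalar_of ?invr_ge0 ?rnorm_ge0// mulVf.
Qed.

Lemma top_dual_normD phi psi : top_dual_norm (phi + psi) <= top_dual_norm phi + top_dual_norm psi.
Proof. 
rewrite /top_dual_norm (_ : top_dual_fun _ = top_dual_fun phi + top_dual_fun psi); last first.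
  by apply/funext => e; rewrite top_dualD.
apply: supnormD; [exact: unit_ball0|exact: top_dual_bounded_on|exact: top_dual_bounded_on].
 Qed.

Lemma top_dual_normZ (a : K) phi : top_dual_norm (a *: phi) = rnorm a * top_dual_norm phi.
Proof. 
rewrite /top_dual_norm (_ : top_dual_fun _ = a *: top_dual_fun phi); last first.
  by apply/funext => e; rewrite top_dualZ.
apply: supnormZ; [exact: unit_ball0|exact: top_dual_bounded_on].
 Qed.

Lemma top_dual_norm0_eq0 phi : top_dual_norm phi = 0 -> phi = 0.
Proof.
move=> p0; apply/val_inj/val_inj/funext => e; apply: rnorm0_eq0.
apply/eqP; rewrite eq_le rnorm_ge0 andbT.
by have := top_dual_normP phi e; rewrite p0 mul0r.
Qed.

HB.instance Definition _ := @Lmodule_isRealNormed.Build R k (top_dual E) top_dual_norm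
  top_dual_normD top_dual_normZ top_dual_norm0_eq0.

Lemma rnorm_top_dual phi : rnorm phi = top_dual_norm phi.
Proof. exact: scalar_ofK. Qed.
End DualNorm.

Section Lip0.
Variables (R : realType) (k : scalar_kind).
Local Notation K := (scalar_field R k).
Variables (X : metricType R) (x0 : X) (F : normedModType K).

Definition lipschitz_constant (f : X -> F) : set R :=
  [set L | 0 <= L /\ forall x y, rnorm (f x - f y) <= L * mdist x y].

Definition lip0_pred : {pred X -> F} :=
  [pred f : X -> F | `[< f x0 = 0 /\ lipschitz_constant f !=set0 >]].

Lemma lipschitz_constantD f g L M : lipschitz_constant f L ->
  lipschitz_constant g M -> lipschitz_constant (f + g) (L + M).
Proof.
move=> [L0 fL] [M0 gM]; split=> [|x y]; first by rewrite addr_ge0.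
rewrite !fctE opprD addrACA (le_trans (rnormD _ _))// mulrDl lerD//.
Qed.

Lemma lipschitz_constantZ (a : K) f L : lipschitz_constant f L ->
  lipschitz_constant (a *: f) (rnorm a * L).
Proof.
move=> [L0 fL]; split=> [|x y]; first by rewrite mulr_ge0 ?rnorm_ge0.
by rewrite !fctE/= -scalerBr rnormZ -mulrA ler_wpM2l ?rnorm_ge0.
Qed.

Lemma lip0_submod_closed : submod_closed lip0_pred.
Proof.
split.
  apply/asboolP; split=> //; exists 0; split=> // x y.
  by rewrite (_ : _ - _ = 0 - 0 :> F)// subr0 rnorm0 mul0r.
move=> a f g /asboolP[f0 [L fL]] /asboolP[g0 [M gM]]; apply/asboolP; split.
  by rewrite !fctE/= f0 g0 scaler0 addr0.
exists (rnorm a * L + M).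
by apply: lipschitz_constantD => //; exact: lipschitz_constantZ.
Qed.

HB.instance Definition _ :=
  GRing.isSubmodClosed.Build K (X -> F) lip0_pred lip0_submod_closed.

Definition Lip0 := submodule lip0_pred.

HB.instance Definition _ := GRing.Lmodule.on Lip0.
End Lip0.

Definition Lip0_fun (R : realType) (k : scalar_kind) (X : metricType R) (x0 : X)
  (F : normedModType (scalar_field R k)) (f : Lip0 x0 F) : X -> F := submodule_val f.
Coercion Lip0_fun : Lip0 >-> Funclass.

Section Lip0Norm.
Variables (R : realType) (k : scalar_kind).
Local Notation K := (scalar_field R k).
Variables (X : metricType R) (x0 : X) (F : normedModType K).
Implicit Types f g : Lip0 x0 F.

Lemma Lip0D f g : Lip0_fun (f + g) = Lip0_fun f + Lip0_fun g.
Proof. by rewrite /Lip0_fun raddfD. Qed.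

Lemma Lip0Z (a : K) f : Lip0_fun (a *: f) = a *: Lip0_fun f.
Proof. by rewrite /Lip0_fun linearZ. Qed.

Lemma Lip0_base f : f x0 = 0.
Proof. by have /asboolP[] := submoduleP f. Qed.

Lemma Lip0_has_constant f : lipschitz_constant f !=set0.
Proof. by have /asboolP[] := submoduleP f. Qed.

Definition Lip f : R := inf (lipschitz_constant f).

Lemma Lip_has_inf f : has_inf (lipschitz_constant f).
Proof. by split; [exact: Lip0_has_constant|exists 0 => L []]. Qed.

Lemma Lip_le f L : lipschitz_constant f L -> Lip f <= L.
Proof. by move=> fL; apply: ge_inf => //; exists 0 => M []. Qed.

Lemma Lip_constant f : lipschitz_constant f (Lip f).
Proof.
split; first by apply: lb_le_inf; [exact: Lip0_has_constant|move=> L []].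
move=> x y; have [d0|d0] := eqVneq (mdist x y) 0.
  by rewrite (mdist_positivity _ _ d0) subrr rnorm0 mdistxx mulr0.
have dp : 0 < mdist x y by rewrite lt_neqAle eq_sym d0 mdist_ge0.
rewrite -ler_pdivrMr//; apply: lb_le_inf; first exact: Lip0_has_constant.
by move=> L [_ fL]; rewrite ler_pdivrMr.
Qed.

Lemma LipD f g : Lip (f + g) <= Lip f + Lip g.
Proof.
by apply: Lip_le; rewrite Lip0D; apply: lipschitz_constantD; exact: Lip_constant.
Qed.

Lemma LipZ (a : K) f : Lip (a *: f) = rnorm a * Lip f.
Proof.
have le_Z (b : K) g : Lip (b *: g) <= rnorm b * Lip g.
  by apply: Lip_le; rewrite Lip0Z; apply: lipschitz_constantZ; exact: Lip_constant.
apply/eqP; rewrite eq_le le_Z/=.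
have [->|a0] := eqVneq a 0.
  by rewrite rnorm0 mul0r; have [] := Lip_constant (0 *: f).
have := le_Z a^-1 (a *: f); rewrite scalerA mulVf// scale1r => h.
rewrite (le_trans (ler_wpM2l _ h)) ?rnorm_ge0// mulrA -rnormM divff//.
by rewrite -[1 in leLHS](scalar_of1 R k) rnorm_scalar_of// mul1r.
Qed.

Lemma Lip0_eq0 f : Lip f = 0 -> f = 0.
Proof.
move=> f0; apply/val_inj/funext => x; apply: rnorm0_eq0.
apply/eqP; rewrite eq_le rnorm_ge0 andbT.
have [_ /(_ x x0)] := Lip_constant f.
by rewrite f0 mul0r Lip0_base subr0.
Qed.

HB.instance Definition _ := @Lmodule_isRealNormed.Build R k (Lip0 x0 F) Lip
  LipD LipZ Lip0_eq0.

Lemma rnorm_Lip f : rnorm f = Lip f.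
Proof. exact: scalar_ofK. Qed.
End Lip0Norm.

Section LipCompact.
Variables (R : realType) (k : scalar_kind).
Local Notation K := (scalar_field R k).
Variables (X : metricType R) (x0 : X) (F : normedModType K).
Implicit Types f g : Lip0 x0 F.

Definition difference_quotients (f : X -> F) : set F :=
  [set v | exists x y, x != y /\
    v = (scalar_of (mdist x y)^-1 : K) *: (f x - f y)].

Definition lipschitz_compact f := precompact (difference_quotients f).

Definition LipK_pred : {pred Lip0 x0 F} :=
  [pred f : Lip0 x0 F | `[< lipschitz_compact f >]].

Lemma LipK_submod_closed : submod_closed LipK_pred.
Proof.
have hF : hausdorff_space F by exact: norm_hausdorff.
split.
  apply/asboolP; apply: (@precompact_subset _ _ [set 0]).
    move=> _ [x [y [_ ->]]]; rewrite /Lip0_fun linear0.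
    by rewrite (_ : _ - _ = 0 - 0 :> F)// subr0 scaler0.
  exact/compact_precompact/compact_set1.
move=> a f g /asboolP[A fA [cA _]] /asboolP[B gB [cB _]]; apply/asboolP.
pose s (p : F * F) := a *: p.1 + p.2.
have cs : continuous s.
  move=> p; rewrite /s; apply: cvgD; last exact: cvg_snd.
  by apply: cvgZl_tmp; exact: cvg_fst.
have cAB : compact (s @` (A `*` B)).
  apply: continuous_compact; last exact: compact_setX.
  exact: continuous_subspaceT.
apply: (@precompact_subset _ _ (s @` (A `*` B))); last exact: compact_precompact.
move=> _ [x [y [xy ->]]].
exists ((scalar_of (mdist x y)^-1 : K) *: (Lip0_fun f x - Lip0_fun f y),
        (scalar_of (mdist x y)^-1 : K) *: (Lip0_fun g x - Lip0_fun g y)).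
  by split; [apply: fA|apply: gB]; exists x, y.
rewrite /s Lip0D Lip0Z !fctE/= scalerA mulrC -scalerA -scalerDr; congr (_ *: _).
by rewrite scalerBr opprD addrACA.
Qed.

HB.instance Definition _ :=
  GRing.isSubmodClosed.Build K (Lip0 x0 F) LipK_pred LipK_submod_closed.

Definition LipK := submodule LipK_pred.

HB.instance Definition _ := GRing.Lmodule.on LipK.

Definition LipK_norm (f : LipK) : R := Lip (submodule_val f).

Lemma LipK_normD (f g : LipK) : LipK_norm (f + g) <= LipK_norm f + LipK_norm g.
Proof. by rewrite /LipK_norm raddfD LipD. Qed.

Lemma LipK_normZ (a : K) (f : LipK) : LipK_norm (a *: f) = rnorm a * LipK_norm f.
Proof. by rewrite /LipK_norm linearZ LipZ. Qed.

Lemma LipK_norm0_eq0 (f : LipK) : LipK_norm f = 0 -> f = 0.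
Proof. by move=> /Lip0_eq0 f0; apply: val_inj. Qed.

HB.instance Definition _ := @Lmodule_isRealNormed.Build R k LipK LipK_norm
  LipK_normD LipK_normZ LipK_norm0_eq0.
End LipCompact.

Lemma alg_dual_sum (K : numFieldType) (V : lmodType K) I (s : seq I)
    (u : I -> alg_dual V) x :
  alg_dual_fun (\sum_(i <- s) u i) x = \sum_(i <- s) alg_dual_fun (u i) x.
Proof.
elim: s => [|i s IH]; last by rewrite !big_cons alg_dualD IH.
by rewrite !big_nil /alg_dual_fun raddf0.
Qed.

Section Tensor.
Variables (R : realType) (k : scalar_kind).
Local Notation K := (scalar_field R k).
Variables (X : metricType R) (x0 : X) (E : normedModType K).
Local Notation XE := (Lip0 x0 (top_dual E)).

(* f |-> <f(x) - f(y), e> *)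
Definition delta_boxtimes_fun (x y : X) (e : E) (f : XE) : K^o :=
  (f x - f y : top_dual E) e.

Lemma delta_boxtimes_linear x y e : delta_boxtimes_fun x y e \in @alg_dual_pred K XE.
Proof.
apply/asboolP => a f g; rewrite /delta_boxtimes_fun Lip0D Lip0Z !fctE/=.
by rewrite opprD addrACA -scalerBr top_dualD top_dualZ.
Qed.

Definition delta_boxtimes x y e : alg_dual XE :=
  Submodule (delta_boxtimes_linear x y e).

Definition tensor :=
  lin_span [set u : alg_dual XE | exists x y e, u = delta_boxtimes x y e].

HB.instance Definition _ := GRing.Lmodule.on tensor.

(* [r] lists the triples [(x_i, y_i, e_i)] of a representation of [u] *)
Definition represents (r : seq (X * X * E)) (u : tensor) : Prop :=
  submodule_val u = \sum_(p <- r) delta_boxtimes p.1.1 p.1.2 p.2.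

Definition repr_cost (r : seq (X * X * E)) : R :=
  \sum_(p <- r) mdist p.1.1 p.1.2 * rnorm p.2.

Definition proj_norm (u : tensor) : R := inf [set repr_cost r | r in represents^~ u].

Definition pairing (g : Lip0 x0 K^o) (phi : top_dual E) (r : seq (X * X * E)) : K^o :=
  \sum_(p <- r) (g p.1.1 - g p.1.2) * phi p.2.

(* the common value of [pairing g phi] over the representations of [u] *)
Definition boxtimes_fun (g : Lip0 x0 K^o) (phi : top_dual E) (u : tensor) : K^o :=
  xget 0 [set s | exists2 r, represents r u & s = pairing g phi r].

Lemma repr_cost_ge0 r : 0 <= repr_cost r.
Proof. by apply: sumr_ge0 => p _; rewrite mulr_ge0 ?mdist_ge0 ?rnorm_ge0. Qed.

Lemma delta_boxtimesZ a x y e : a *: delta_boxtimes x y e = delta_boxtimes x y (a *: e).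
Proof.
apply/val_inj/funext => f.
rewrite [LHS](alg_dualZ a (delta_boxtimes x y e)).
by rewrite [RHS]/(delta_boxtimes_fun _ _ _ _) /delta_boxtimes_fun linearZ.
Qed.

Lemma represents_exists u : exists r, represents r u.
Proof.
have /asboolP[n [a [w [Aw uE]]]] := submoduleP u.
have /choice[t wt] : forall i, exists t : X * X * E,
    w i = delta_boxtimes t.1.1 t.1.2 t.2.
  by move=> i; have [x [y [e ->]]] := Aw i; exists (x, y, e).
exists [seq ((t i).1, a i *: (t i).2) | i <- enum 'I_n].
rewrite /represents uE big_map big_enum/=.
by apply: eq_bigr => i _; rewrite wt delta_boxtimesZ.
Qed.

Lemma represents0 : represents [::] 0.
Proof. by rewrite /represents big_nil raddf0. Qed.

Lemma representsD r s u v : represents r u -> represents s v ->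
  represents (r ++ s) (u + v).
Proof. by rewrite /represents raddfD/= big_cat => -> ->. Qed.

Definition scale_repr (a : K) (r : seq (X * X * E)) := [seq (p.1, a *: p.2) | p <- r].

Lemma representsZ a r u : represents r u -> represents (scale_repr a r) (a *: u).
Proof.
rewrite /represents linearZ/= => ->; rewrite scaler_sumr big_map.
by apply: eq_bigr => p _; rewrite delta_boxtimesZ.
Qed.

Lemma repr_cost_scale a r : repr_cost (scale_repr a r) = rnorm a * repr_cost r.
Proof.
rewrite /repr_cost big_map mulr_sumr; apply: eq_bigr => p _.
by rewrite rnormZ mulrCA.
Qed.

Lemma proj_norm_le r u : represents r u -> proj_norm u <= repr_cost r.
Proof.
by move=> ru; apply: ge_inf; [exists 0 => _ [s _ <-]; exact: repr_cost_ge0|exists r].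
Qed.

Lemma proj_norm_lt u c : proj_norm u < c -> exists2 r, represents r u & repr_cost r < c.
Proof.
move=> uc; have hi : has_inf [set repr_cost r | r in represents^~ u].
  split; first by have [r ru] := represents_exists u; exists (repr_cost r), r.
  by exists 0 => _ [s _ <-]; exact: repr_cost_ge0.
have e0 : 0 < c - proj_norm u by rewrite subr_gt0.
have [_ [r ru <-]] := inf_adherent e0 hi.
by rewrite addrC subrK => rc; exists r.
Qed.

Lemma lip_scale_subproof (g : Lip0 x0 K^o) (phi : top_dual E) :
  (fun x => (g x : K) *: phi) \in @lip0_pred R k X x0 (top_dual E).
Proof.
apply/asboolP; split; first by rewrite Lip0_base scale0r.
have [L0 gL] := Lip_constant g.
exists (Lip g * rnorm phi); split=> [|x y]; first by rewrite mulr_ge0 ?rnorm_ge0.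
by rewrite -scalerBl rnormZ mulrAC ler_wpM2r ?rnorm_ge0.
Qed.

(* the map x |-> g(x) phi, used to see that [boxtimes_fun g phi] is well defined *)
Definition lip_scale g phi : XE := Submodule (lip_scale_subproof g phi).

Lemma pairing_represents g phi r u : represents r u ->
  pairing g phi r = alg_dual_fun (submodule_val u) (lip_scale g phi).
Proof.
move=> ->; rewrite alg_dual_sum; apply: eq_bigr => p _.
rewrite [RHS]/(delta_boxtimes_fun _ _ _ _) /delta_boxtimes_fun.
rewrite [in RHS](_ : _ - _ = (g p.1.1 - g p.1.2 : K) *: phi) ?top_dualZ//.
by rewrite scalerBl.
Qed.

Lemma boxtimes_fun_val g phi u :
  boxtimes_fun g phi u = alg_dual_fun (submodule_val u) (lip_scale g phi).
Proof.
rewrite /boxtimes_fun; case: xgetP => [_ -> [r ru ->]|noval].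
  exact: pairing_represents.
have [r ru] := represents_exists u.
by exfalso; apply: (noval (pairing g phi r)); exists r.
Qed.

Lemma boxtimes_funE g phi r u : represents r u -> boxtimes_fun g phi u = pairing g phi r.
Proof. by move=> ru; rewrite boxtimes_fun_val (pairing_represents _ _ ru). Qed.

Lemma boxtimes_linear g phi : boxtimes_fun g phi \in @alg_dual_pred K tensor.
Proof.
apply/asboolP => a u v; rewrite !boxtimes_fun_val.
by rewrite linearD linearZ alg_dualD alg_dualZ.
Qed.

Definition boxtimes g phi : alg_dual tensor := Submodule (boxtimes_linear g phi).

Lemma boxtimesE g phi u : alg_dual_fun (boxtimes g phi) u = boxtimes_fun g phi u.
Proof. by []. Qed.

Definition circledast :=
  lin_span [set v : alg_dual tensor | exists g phi, v = boxtimes g phi].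

HB.instance Definition _ := GRing.Lmodule.on circledast.
End Tensor.

Definition circledast_fun (R : realType) (k : scalar_kind) (X : metricType R)
    (x0 : X) (E : normedModType (scalar_field R k)) (v : circledast x0 E) :
    tensor x0 E -> (scalar_field R k)^o :=
  (submodule_val v : alg_dual (tensor x0 E)).
Coercion circledast_fun : circledast >-> Funclass.

Section DualNormTensor.
Variables (R : realType) (k : scalar_kind).
Local Notation K := (scalar_field R k).
Variables (X : metricType R) (x0 : X) (E : normedModType K).
Implicit Types v w : circledast x0 E.

Definition proj_unit_ball : set (tensor x0 E) := [set u | proj_norm u <= 1].

(* the dual norm of [proj_norm] *)
Definition proj_dual_norm v : R := supnorm proj_unit_ball v.

Lemma proj_unit_ball0 : proj_unit_ball !=set0.
Proof.
exists 0; rewrite /proj_unit_ball/= (le_trans (proj_norm_le (represents0 _ _)))//.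
by rewrite /repr_cost big_nil.
Qed.

Lemma pairing_bound (g : Lip0 x0 K^o) (phi : top_dual E) r :
  rnorm (pairing g phi r) <= Lip g * rnorm phi * repr_cost r.
Proof.
elim: r => [|p r IH]; first by rewrite /pairing /repr_cost !big_nil rnorm0 mulr0.
rewrite /pairing /repr_cost !big_cons (le_trans (rnormD _ _))// mulrDr lerD//.
have [L0 gL] := Lip_constant g.
rewrite rnormM mulrACA ler_pM ?rnorm_ge0 ?gL//.
by rewrite rnorm_top_dual top_dual_normP.
Qed.

Lemma circledast_bound v :
  exists2 C : R, 0 <= C & forall r u, represents r u -> rnorm (v u) <= C * repr_cost r.
Proof.
have /asboolP[n [a [w [Aw vE]]]] := submoduleP v.
have /choice[C hC] : forall i, exists C : R, 0 <= C /\
    forall r u, represents r u -> rnorm (alg_dual_fun (w i) u) <= C * repr_cost r.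
  move=> i; have [g [phi ->]] := Aw i; exists (Lip g * rnorm phi).
  split=> [|r u ru]; first by rewrite mulr_ge0 ?rnorm_ge0//; have [] := Lip_constant g.
  rewrite boxtimesE (boxtimes_funE _ _ ru).
  exact: pairing_bound.
exists (\sum_(i < n) rnorm (a i) * C i).
  by apply: sumr_ge0 => i _; rewrite mulr_ge0 ?rnorm_ge0//; case: (hC i).
move=> r u ru; rewrite /circledast_fun vE alg_dual_sum mulr_suml.
elim/big_ind2 : _ => [|x1 x2 y1 y2 h1 h2|i _]; first by rewrite rnorm0.
  by rewrite (le_trans (rnormD _ _))// lerD.
rewrite alg_dualZ rnormZ -mulrA ler_wpM2l ?rnorm_ge0//.
by have [_] := hC i; exact.
Qed.

Lemma circledast_bounded_on v : bounded_on proj_unit_ball v.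
Proof.
have [C C0 hC] := circledast_bound v; exists (C * 2) => u u1.
have [r ru r2] : exists2 r, represents r u & repr_cost r < 2.
  by apply: proj_norm_lt; rewrite (le_lt_trans u1)// ltr1n.
by rewrite (le_trans (hC _ _ ru))// ler_wpM2l// ltW.
Qed.

Lemma circledastD v w : circledast_fun (v + w) = circledast_fun v + circledast_fun w.
Proof. by apply/funext => u; rewrite /circledast_fun raddfD alg_dualD. Qed.

Lemma circledastZ (a : K) v : circledast_fun (a *: v) = a *: circledast_fun v.
Proof. by apply/funext => u; rewrite /circledast_fun linearZ alg_dualZ. Qed.

Lemma proj_dual_normD v w :
  proj_dual_norm (v + w) <= proj_dual_norm v + proj_dual_norm w.
Proof.
rewrite /proj_dual_norm circledastD.
apply: supnormD; [exact: proj_unit_ball0|exact: circledast_bounded_on..].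
Qed.

Lemma proj_dual_normZ (a : K) v : proj_dual_norm (a *: v) = rnorm a * proj_dual_norm v.
Proof.
rewrite /proj_dual_norm circledastZ.
apply: supnormZ; [exact: proj_unit_ball0|exact: circledast_bounded_on].
Qed.

Lemma proj_dual_norm0_eq0 v : proj_dual_norm v = 0 -> v = 0.
Proof.
move=> v0; apply/val_inj/val_inj/funext => u.
have [r ru] := represents_exists u.
have c0 : 0 < 1 + repr_cost r by rewrite ltr_wpDr ?repr_cost_ge0.
pose t : K := scalar_of (1 + repr_cost r)^-1.
have tE : rnorm t = (1 + repr_cost r)^-1 by rewrite rnorm_scalar_of// invr_ge0 ltW.
have t0 : t != 0.
  by apply/eqP => tz; move: tE; rewrite tz rnorm0 => /esym/eqP; rewrite invr_eq0 gt_eqF.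
have tu1 : proj_unit_ball (t *: u).
  rewrite /proj_unit_ball/= (le_trans (proj_norm_le (representsZ t ru)))//.
  by rewrite repr_cost_scale tE mulrC ler_pdivrMr// mul1r lerDr.
have := supnorm_ge proj_unit_ball0 (circledast_bounded_on v) tu1.
rewrite -/(proj_dual_norm v) v0 => h.
have : circledast_fun v (t *: u) = 0.
  by apply: rnorm0_eq0; apply/eqP; rewrite eq_le h rnorm_ge0.
rewrite /circledast_fun linearZ => /eqP; rewrite scaler_eq0 (negPf t0) => /eqP.
exact.
Qed.

HB.instance Definition _ := @Lmodule_isRealNormed.Build R k (circledast x0 E)
  proj_dual_norm proj_dual_normD proj_dual_normZ proj_dual_norm0_eq0.
End DualNormTensor.

Section CauchySequences.
Variables (R : realType) (k : scalar_kind).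
Local Notation K := (scalar_field R k).
Variable V : normedModType K.

Definition cauchy_seq_pred : {pred nat -> V} :=
  [pred u : nat -> V | `[< forall e : R, 0 < e -> exists N : nat,
    forall m n, (N <= m)%N -> (N <= n)%N -> rnorm (u m - u n) < e >]].

Lemma cauchy_seq_submod_closed : submod_closed cauchy_seq_pred.
Proof.
split.
  apply/asboolP => e e0; exists 0%N => m n _ _.
  by rewrite (_ : _ - _ = 0 - 0 :> V)// subr0 rnorm0.
move=> a u v /asboolP cu /asboolP cv; apply/asboolP => e e0.
have a0 : 0 < 1 + rnorm a by rewrite ltr_wpDr ?rnorm_ge0.
have [N hN] := cu (e / 2 / (1 + rnorm a)) (divr_gt0 (divr_gt0 e0 (ltr0Sn R 1)) a0).
have [M hM] := cv (e / 2) (divr_gt0 e0 (ltr0Sn R 1)).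
exists (maxn N M) => m n; rewrite !geq_max => /andP[Nm Mm] /andP[Nn Mn].
rewrite !fctE/= opprD addrACA -scalerBr (le_lt_trans (rnormD _ _))//.
rewrite [e]splitr ler_ltD ?hM//.
have := hN _ _ Nm Nn; rewrite ltr_pdivlMr// => /ltW; apply: le_trans.
by rewrite rnormZ mulrC ler_wpM2l ?rnorm_ge0// lerDr.
Qed.

HB.instance Definition _ :=
  GRing.isSubmodClosed.Build K (nat -> V) cauchy_seq_pred cauchy_seq_submod_closed.

Definition cauchy_seq := submodule cauchy_seq_pred.

HB.instance Definition _ := GRing.Lmodule.on cauchy_seq.
End CauchySequences.

Definition cauchy_seq_fun (R : realType) (k : scalar_kind)
  (V : normedModType (scalar_field R k)) (u : cauchy_seq V) : nat -> V := submodule_val u.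
Coercion cauchy_seq_fun : cauchy_seq >-> Funclass.

Section Completion.
Variables (R : realType) (k : scalar_kind).
Local Notation K := (scalar_field R k).
Variable V : normedModType K.
Implicit Types u v : cauchy_seq V.

Lemma cauchy_seqP u (e : R) : 0 < e -> exists N : nat,
  forall m n, (N <= m)%N -> (N <= n)%N -> rnorm (u m - u n) < e.
Proof. by have /asboolP h := submoduleP u; exact: h. Qed.

Lemma cauchy_seqD u v : cauchy_seq_fun (u + v) = cauchy_seq_fun u + cauchy_seq_fun v.
Proof. by rewrite /cauchy_seq_fun raddfD. Qed.

Lemma cauchy_seqZ (a : K) u : cauchy_seq_fun (a *: u) = a *: cauchy_seq_fun u.
Proof. by rewrite /cauchy_seq_fun linearZ. Qed.

Lemma cauchy_seqB u v : cauchy_seq_fun (u - v) = cauchy_seq_fun u - cauchy_seq_fun v.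
Proof. by rewrite /cauchy_seq_fun raddfB. Qed.

Lemma rnorm_dist (x y : V) : `|rnorm x - rnorm y| <= rnorm (x - y).
Proof.
have tri a b : rnorm a <= rnorm (a - b) + rnorm b :> R.
  by rewrite -{1}(subrK b a) rnormD.
by rewrite ler_norml lerBlDr tri andbT lerNl opprB lerBlDr rnormB tri.
Qed.

Lemma rnorm_cauchy_cvg u : cvgn (fun n => rnorm (u n)).
Proof.
apply: cauchy_cvg; apply/cauchy_exP => e e0.
have [N hN] := cauchy_seqP u e0.
exists (rnorm (u N)); exists N => // n /= Nn; rewrite /ball/=.
by rewrite (le_lt_trans (rnorm_dist _ _))// hN.
Qed.

Definition seq_norm u : R := limn (fun n => rnorm (u n)).

Lemma seq_norm_le u c (N : nat) :
  (forall n, (N <= n)%N -> rnorm (u n) <= c) -> seq_norm u <= c.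
Proof.
by move=> h; apply: limr_le; [exact: rnorm_cauchy_cvg|exists N => // n /= Nn; exact: h].
Qed.

Lemma seq_normD u v : seq_norm (u + v) <= seq_norm u + seq_norm v.
Proof.
rewrite /seq_norm -limD; [|exact: rnorm_cauchy_cvg..].
apply: ler_lim; [exact: rnorm_cauchy_cvg| |].
  by apply: is_cvgD; exact: rnorm_cauchy_cvg.
by near=> n; rewrite cauchy_seqD !fctE; exact: rnormD.
Unshelve. all: by end_near. Qed.

Lemma seq_normZ (a : K) u : seq_norm (a *: u) = rnorm a * seq_norm u.
Proof.
rewrite /seq_norm cauchy_seqZ.
rewrite (_ : (fun n => _) = (fun n => rnorm a * rnorm (u n))); last first.
  by apply/funext => n; rewrite !fctE/= rnormZ.
by apply/cvg_lim => //; apply: cvgMr; exact: rnorm_cauchy_cvg.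
Qed.

Lemma seq_norm_ge0 u : 0 <= seq_norm u.
Proof.
apply: limr_ge; first exact: rnorm_cauchy_cvg.
by near=> n; exact: rnorm_ge0.
Unshelve. all: by end_near. Qed.

Definition null_pred : {pred cauchy_seq V} :=
  [pred u : cauchy_seq V | seq_norm u == 0].

Lemma null_submod_closed : submod_closed null_pred.
Proof.
split; first by rewrite inE -(scale0r 0) seq_normZ rnorm0 mul0r.
move=> a u v; rewrite !inE => /eqP u0 /eqP v0; rewrite eq_le seq_norm_ge0 andbT.
by rewrite (le_trans (seq_normD _ _))// seq_normZ u0 v0 mulr0 addr0.
Qed.

HB.instance Definition _ :=
  GRing.isSubmodClosed.Build K (cauchy_seq V) null_pred null_submod_closed.

(* Cauchy sequences modulo null sequences *)
Definition completion := Quotient.quot null_pred.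

HB.instance Definition _ := GRing.Zmodule.on completion.

Definition cauchy_class u : completion := \pi_(Quotient.quot null_pred)%qT u.

Definition class_seq (q : completion) : cauchy_seq V :=
  repr (q : Quotient.quot null_pred).

Lemma class_seqK q : cauchy_class (class_seq q) = q.
Proof. exact: reprK. Qed.

Lemma cauchy_class_eq u v : (cauchy_class u = cauchy_class v) <-> seq_norm (u - v) = 0.
Proof.
split=> [/eqP|h]; last apply/eqP.
  by rewrite /cauchy_class -Quotient.idealrBE inE => /eqP.
by rewrite /cauchy_class -Quotient.idealrBE inE h.
Qed.

Lemma cauchy_classB u v : cauchy_class (u - v) = cauchy_class u - cauchy_class v.
Proof. exact: pi_is_zmod_morphism. Qed.

Lemma cauchy_classD u v : cauchy_class (u + v) = cauchy_class u + cauchy_class v.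
Proof.
have h0 : cauchy_class 0 = 0 by rewrite -(subrr 0) cauchy_classB subrr.
have hN w : cauchy_class (- w) = - cauchy_class w.
  by rewrite -[- w]sub0r cauchy_classB h0 sub0r.
by rewrite -[v in LHS]opprK cauchy_classB hN opprK.
Qed.

Lemma seq_norm_eq u v : seq_norm (u - v) = 0 -> seq_norm u = seq_norm v.
Proof.
move=> uv0; apply/eqP; rewrite eq_le; apply/andP; split.
  by rewrite -{1}(subrK v u) (le_trans (seq_normD _ _))// uv0 add0r.
rewrite -{1}(subrK u v) (le_trans (seq_normD _ _))//.
by rewrite -opprB -scaleN1r seq_normZ uv0 mulr0 add0r.
Qed.

Definition completion_scale (a : K) (q : completion) : completion :=
  cauchy_class (a *: class_seq q).

Lemma completion_scale_class a u :
  completion_scale a (cauchy_class u) = cauchy_class (a *: u).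
Proof.
apply/cauchy_class_eq; rewrite -scalerBr seq_normZ.
by have /cauchy_class_eq -> := class_seqK (cauchy_class u); rewrite mulr0.
Qed.

Lemma completion_scaleA a b q :
  completion_scale a (completion_scale b q) = completion_scale (a * b) q.
Proof. by rewrite {2}/completion_scale completion_scale_class scalerA. Qed.

Lemma completion_scale1 : left_id 1 completion_scale.
Proof. by move=> q; rewrite /completion_scale scale1r class_seqK. Qed.

Lemma completion_scaleDr : right_distributive completion_scale +%R.
Proof.
move=> a p q; rewrite -{1}(class_seqK p) -{1}(class_seqK q) -cauchy_classD.
by rewrite completion_scale_class scalerDr cauchy_classD.
Qed.

Lemma completion_scaleDl q : {morph completion_scale^~ q : a b / a + b}.
Proof. by move=> a b; rewrite /completion_scale scalerDl cauchy_classD. Qed.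

HB.instance Definition _ := GRing.Zmodule_isLmodule.Build K completion
  completion_scaleA completion_scale1 completion_scaleDr completion_scaleDl.

Lemma cauchy_classZ (a : K) u : cauchy_class (a *: u) = a *: cauchy_class u.
Proof. by rewrite -completion_scale_class. Qed.

Definition completion_norm (q : completion) : R := seq_norm (class_seq q).

Lemma completion_norm_class u : completion_norm (cauchy_class u) = seq_norm u.
Proof. by apply/seq_norm_eq/cauchy_class_eq; rewrite class_seqK. Qed.

Lemma completion_normD p q :
  completion_norm (p + q) <= completion_norm p + completion_norm q.
Proof.
rewrite -{1}(class_seqK p) -{1}(class_seqK q) -cauchy_classD completion_norm_class.
exact: seq_normD.
Qed.

Lemma completion_normZ (a : K) q :
  completion_norm (a *: q) = rnorm a * completion_norm q.
Proof.
by rewrite -{1}(class_seqK q) -cauchy_classZ completion_norm_class seq_normZ.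
Qed.

Lemma completion_norm0_eq0 q : completion_norm q = 0 -> q = 0.
Proof.
move=> q0; rewrite -(class_seqK q) -(subrr (cauchy_class 0)) -cauchy_classB.
by apply/cauchy_class_eq; rewrite subrr subr0.
Qed.

HB.instance Definition _ := @Lmodule_isRealNormed.Build R k completion
  completion_norm completion_normD completion_normZ completion_norm0_eq0.

Lemma rnorm_completion (q : completion) : rnorm q = completion_norm q.
Proof. exact: scalar_ofK. Qed.

Lemma cst_cauchy (x : V) : (fun=> x) \in @cauchy_seq_pred R k V.
Proof. by apply/asboolP => e e0; exists 0%N => m n _ _; rewrite subrr rnorm0. Qed.

Definition to_completion (x : V) : completion :=
  cauchy_class (Submodule (cst_cauchy x)).

Lemma to_completion_linear : linear to_completion.
Proof.
move=> a x y; rewrite /to_completion -cauchy_classZ -cauchy_classD.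
congr cauchy_class; apply: val_inj.
by rewrite [RHS]cauchy_seqD cauchy_seqZ.
Qed.

HB.instance Definition _ := GRing.isLinear.Build K V completion _ to_completion
  to_completion_linear.

Lemma rnorm_to_completion x : rnorm (to_completion x) = rnorm x.
Proof.
rewrite rnorm_completion completion_norm_class.
rewrite /seq_norm (_ : (fun n => _) = (fun=> rnorm x))//.
exact: lim_cst.
Qed.

Lemma rnorm_class_le u (x : V) c (N : nat) :
  (forall n, (N <= n)%N -> rnorm (u n - x) <= c) ->
  rnorm (cauchy_class u - to_completion x) <= c.
Proof.
move=> h; rewrite -cauchy_classB rnorm_completion completion_norm_class.
by apply: (@seq_norm_le _ _ N) => n Nn; rewrite cauchy_seqB; exact: h.
Qed.

Lemma to_completion_dense (q : completion) (e : R) : 0 < e ->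
  exists x, rnorm (q - to_completion x) < e.
Proof.
move=> e0; have e20 : 0 < e / 2 by rewrite divr_gt0.
have [N hN] := cauchy_seqP (class_seq q) e20.
exists (class_seq q N); rewrite -{1}(class_seqK q).
rewrite (@le_lt_trans _ _ (e / 2))//; last by rewrite ltr_pdivrMr// ltr_pMr// ltr1n.
by apply: (@rnorm_class_le _ _ _ N) => n Nn; rewrite ltW// hN.
Qed.

Lemma completion_complete (F : set_system completion) :
  ProperFilter F -> cauchy F -> cvg F.
Proof.
move=> FF /cauchyP cF.
pose e (n : nat) : R := n.+1%:R^-1.
have e0 n : 0 < e n by rewrite invr_gt0.
have /choice[z hz] : forall n, exists z, F (ball z (scalar_of (e n) : K)).
  by move=> n; apply: cF; rewrite -(scalar_of0 R k) ltr_scalar_of.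
have /choice[x hx] : forall n, exists x, rnorm (z n - to_completion x) < e n.
  by move=> n; exact: to_completion_dense.
have zz m n : rnorm (z m - z n) < e m + e n.
  have [w [zmw znw]] := filter_ex (filterI (hz m) (hz n)).
  move: zmw znw; rewrite !rnorm_ball => zmw znw.
  rewrite -(subrKA w) (le_lt_trans (rnormD _ _))// ltrD//.
  by rewrite rnormB.
have xx m n : rnorm (x m - x n) <= e m + (e m + e n + e n).
  rewrite -rnorm_to_completion raddfB/=.
  have -> : to_completion (x m) - to_completion (x n) =
      (to_completion (x m) - z m) + ((z m - z n) + (z n - to_completion (x n))).
    by rewrite !subrKA.
  rewrite (le_trans (rnormD _ _))// lerD//; first by rewrite rnormB ltW.
  by rewrite (le_trans (rnormD _ _))// lerD// ltW.
have eN (d : R) : 0 < d -> exists N : nat, forall n, (N <= n)%N -> e n < d.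
  by move=> d0; have [N _ hN] := near_infty_natSinv_lt (PosNum d0); exists N.
have cx : x \in @cauchy_seq_pred R k V.
  apply/asboolP => d d0; have [|N hN] := eN (d / 4); first by rewrite divr_gt0.
  exists N => m n Nm Nn; have := hN _ Nm; have := hN _ Nn; have := xx m n; lra.
pose u : cauchy_seq V := Submodule cx.
apply/cvg_ex; exists (cauchy_class u); apply/cvg_ballP => d d0.
have dE := scalar_reK (ltW d0); rewrite -dE; move: (scalar_re d) dE => r dE.
have r0 : 0 < r by rewrite -(ltr_scalar_of k) dE scalar_of0.
have [|N hN] := eN (r / 8); first by rewrite divr_gt0.
have qN : rnorm (cauchy_class u - to_completion (x N)) <= r / 2.
  apply: (@rnorm_class_le _ _ _ N) => n Nn; rewrite [u n](_ : _ = x n)//.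
  by have := hN _ Nn; have := hN _ (leqnn N); have := xx n N; lra.
apply: filterS (hz N) => w; rewrite !rnorm_ball => zw.
have -> : cauchy_class u - w = (cauchy_class u - to_completion (x N)) +
    ((to_completion (x N) - z N) + (z N - w)) by rewrite !subrKA.
have h1 := rnormD (cauchy_class u - to_completion (x N))
  ((to_completion (x N) - z N) + (z N - w)).
have h2 := rnormD (to_completion (x N) - z N) (z N - w).
have h3 := hx N; rewrite rnormB in h3.
have h4 := hN _ (leqnn N); lra.
Qed.

HB.instance Definition _ := Uniform_isComplete.Build completion completion_complete.
End Completion.

Section Properties.
Variables (R : realType) (k : scalar_kind).
Local Notation K := (scalar_field R k).

Definition bounded_operator (Z W : normedModType K) (T : Z -> W) :=
  exists C : R, forall z, rnorm (T z) <= C * rnorm z.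

Definition finite_rank (Z W : lmodType K) (T : Z -> W) :=
  exists s : seq W, forall z, T z \in lin_span_pred [set` s].

Definition approximation_property (Z : normedModType K) :=
  forall (C : set Z) (eta : R), compact C -> 0 < eta ->
  exists T : {linear Z -> Z},
    [/\ bounded_operator T, finite_rank T &
        forall z, C z -> rnorm (T z - z) < eta].

Definition isometrically_isomorphic (V W : normedModType K) :=
  exists T : {linear V -> W}, bijective T /\ forall v, `|T v| = `|v|.
End Properties.

(* Main.v *)
From HB Require Import structures.
Require Import Defs.
From mathcomp Require Import all_boot all_order all_algebra.
From mathcomp Require Import complex finmap.
From mathcomp Require Import boolp classical_sets functions reals topology.
From mathcomp Require Import interval_inference normedtype sequences lra.

(** Every [v] in [circledast x0 E] acts on the tensors by [v u = u f] for a
    single Lipschitz map [f : X -> E^*]: if [v] is a sum of terms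
    [g_i boxtimes phi_i], then [f x] is the sum of the [g_i x *: phi_i].  This
    assignment is linear, and it is isometric ([represented_by_isometry]): a
    representation of [u] with cost [c] gives [|u f| <= Lip f * c], and in the
    other direction the elementary tensors [delta_(x,y) boxtimes e] already
    recover [Lip f].  Each [f] so obtained has its difference quotients in a
    finite sum of bounded pieces of lines, so it is Lipschitz compact.  Since
    the space of Lipschitz compact maps is complete ([LipK_complete]), it is
    the completion of [circledast x0 E] as soon as the maps [f] are dense in it
    ([isometric_completion]).

    Density ([represented_dense]) is where the approximation property enters.
    A map [f : X -> E^*] has a transpose [e |-> (x |-> f x e)] from [E] to
    [X^#].  As for Schauder's theorem on adjoints, Lipschitz compactness of [f]
    makes the transpose a compact operator ([transpose_totally_bounded]): the
    difference quotients of [f] are approximated by finitely many functionals,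
    and finitely many vectors of the unit ball of [E] suffice to approximate
    their values on that ball.  Hence a bounded finite-rank operator [T] on
    [X^#] moves each transpose of a unit vector by less than a given amount.
    The range of [T] is a finite-dimensional space of functions, so its members
    are determined by interpolation at finitely many points:
    [z = \sum_p z(x_p) *: g_p] for all [z] in the range
    ([finite_interpolation]).  Setting [phi_p e := T (transpose f e) (x_p)]
    yields continuous functionals on [E], because evaluation at a point is
    bounded on [X^#], and the sum of the [g_p boxtimes phi_p] represents a map
    whose transpose is [T] composed with that of [f].  The transpose
    determines the Lipschitz norm, so this map is close to [f]. *)

Set Implicit Arguments.
Unset Strict Implicit.
Unset Printing Implicit Defensive.

Import Order.TTheory GRing.Theory Num.Theory.
Import numFieldNormedType.Exports.

Local Open Scope classical_set_scope.
Local Open Scope ring_scope.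

(** * Cauchy filters and completeness in terms of real-valued norms *)

Section RealFilters.
Context (R : realType) (k : scalar_kind).
Local Notation K := (scalar_field R k).
Implicit Types V W : normedModType K.

Lemma scalar_of_gt0 (e : K) : 0 < e -> exists2 r : R, 0 < r & e = scalar_of r.
Proof.
move=> e0; exists (scalar_re e); last by rewrite scalar_reK// ltW.
by rewrite -(ltr_scalar_of k) scalar_of0 scalar_reK// ltW.
Qed.

Lemma cauchy_rnormP V (F : set_system V) {FF : ProperFilter F} :
  cauchy F <-> forall e : R, 0 < e -> exists x, F [set y | rnorm (x - y) < e].
Proof.
rewrite cauchyP; split=> [cF e e0|cF _ /scalar_of_gt0[e e0 ->]].
  have [|x Fx] := cF (scalar_of e); first by rewrite -(scalar_of0 R k) ltr_scalar_of.
  by exists x; apply: filterS Fx => y; rewrite rnorm_ball.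
have [x Fx] := cF e e0.
by exists x; apply: filterS Fx => y; rewrite rnorm_ball.
Qed.

Lemma cvg_rnormP V (F : set_system V) {FF : Filter F} (l : V) :
  F --> l <-> forall e : R, 0 < e -> F [set y | rnorm (l - y) < e].
Proof.
have fE : (F --> l) <-> _ := cvg_ballP id l.
split=> [/fE Fl e e0|Fl].
  have := Fl (scalar_of e); rewrite -(scalar_of0 R k) ltr_scalar_of => /(_ e0).
  by apply: filterS => y; rewrite rnorm_ball.
apply/fE => _ /scalar_of_gt0[e e0 ->].
by apply: filterS (Fl e e0) => y; rewrite rnorm_ball.
Qed.

Definition cauchy_complete V := forall F : set_system V,
  ProperFilter F -> cauchy F -> cvg F.

Lemma rnorm_closed_ball_near V (F : set_system V) {FF : ProperFilter F} l z (e : R) :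
  F --> l -> F [set y | rnorm (z - y) < e] -> rnorm (l - z) <= e.
Proof.
move=> /cvg_rnormP Fl Fz; apply/ler_addgt0Pr => d d0.
have [y [zy ly]] := filter_ex (filterI Fz (Fl d d0)).
rewrite -(subrKA y) (le_trans (rnormD _ _))// addrC lerD ?(ltW ly)//.
by rewrite rnormB ltW.
Qed.

Lemma cauchy_seq_cvg V (u : nat -> V) : cauchy_complete V ->
  (forall e : R, 0 < e -> exists N : nat, forall m n, (N <= m)%N -> (N <= n)%N ->
    rnorm (u m - u n) < e) ->
  exists l, forall e : R, 0 < e -> exists N : nat, forall n, (N <= n)%N ->
    rnorm (u n - l) < e.
Proof.
move=> cV cu.
have /cV/cvg_ex[l] : cauchy (u @ \oo).
  apply/cauchy_rnormP => e /cu[N uN]; exists (u N).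
  by exists N => // n /= Nn; exact: uN.
move=> /cvg_rnormP ul; exists l => e /ul[N _ uN]; exists N => n Nn.
by rewrite rnormB; exact: uN.
Qed.

End RealFilters.

Section Completeness.
Context (R : realType) (k : scalar_kind).
Local Notation K := (scalar_field R k).

(** The argument common to dual spaces and spaces of Lipschitz maps: the
    evaluations along a Cauchy filter have limits, and these are approached
    uniformly relative to the weights [w], so that limits of evaluations which
    are uniformly approximable come from a vector of [V]. *)
Lemma complete_of_evaluations (V F : normedModType K) (I : Type)
    (ev : I -> {linear V -> F}) (w : I -> R) :
  cauchy_complete F -> (forall i, 0 <= w i) ->
  (forall i v, rnorm (ev i v) <= rnorm v * w i) ->
  (forall v c, 0 <= c -> (forall i, rnorm (ev i v) <= c * w i) -> rnorm v <= c) ->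
  (forall l : I -> F, (forall e : R, 0 < e ->
      exists z, forall i, rnorm (l i - ev i z) <= e * w i) ->
    exists v, forall i, ev i v = l i) ->
  cauchy_complete V.
Proof.
move=> cF w0 ev_le norm_le closed_ev G GG /cauchy_rnormP cG.
have evG i : exists l : F, (ev i @ G : set_system F) --> l.
  apply/cvg_ex; apply: cF.
  apply/cauchy_rnormP => e e0.
  have w1 : 0 < 1 + w i by rewrite ltr_wpDr.
  have [x Gx] := cG _ (divr_gt0 e0 w1); exists (ev i x).
  apply: (filterS (F := G) _ Gx) => y /= xy; rewrite -raddfB (le_lt_trans (ev_le _ _))//.
  move: xy; rewrite ltr_pdivlMr// => xy.
  apply: le_lt_trans xy; rewrite ler_wpM2l ?rnorm_ge0// lerDr//.
have /choice[l hl] := evG.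
have near_l z (e : R) : 0 < e -> G [set y | rnorm (z - y) < e] ->
    forall i, rnorm (l i - ev i z) <= e * w i.
  move=> e0 Gz i; apply/ler_addgt0Pr => d d0.
  apply: (rnorm_closed_ball_near (hl i)).
  apply: (filterS (F := G) _ Gz) => y /= zy; rewrite -raddfB (le_lt_trans (ev_le _ _))//.
  by rewrite (le_lt_trans (ler_wpM2r (w0 i) (ltW zy)))// ltrDl.
have [|v vl] := closed_ev l.
  by move=> e e0; have [z /(near_l _ _ e0)] := cG e e0; exists z.
apply/cvg_ex; exists v; apply/cvg_rnormP => e e0.
have e20 : 0 < e / 2 by rewrite divr_gt0.
have [z Gz] := cG _ e20; apply: filterS (Gz) => y /= zy.
rewrite -(subrKA z) (le_lt_trans (rnormD _ _))// [e]splitr ler_ltD//.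
apply: norm_le => [|i]; first exact: ltW.
by rewrite raddfB/= vl; exact: near_l.
Qed.

End Completeness.

(** * The scalar field: completeness and finite nets *)

Section Scalars.
Context (R : realType) (k : scalar_kind).
Local Notation K := (scalar_field R k).
Implicit Types a b : K.

Definition scalar_im : K -> R :=
  match k return scalar_field R k -> R with
  | real_scalars => fun=> 0
  | complex_scalars => fun z => complex.Im z
  end.

(** Discarding [y] over the reals is what lets [rnorm_sub_mk] hold for both
    kinds of scalars, and the proofs below treat them at once. *)
Definition scalar_mk (x y : R) : K :=
  match k return scalar_field R k with
  | real_scalars => x
  | complex_scalars => (x +i* y)%C
  end.

Lemma scalar_reB a b : scalar_re (a - b) = scalar_re a - scalar_re b.
Proof. by move: a b; rewrite /scalar_re; case: k => // -[? ?] [? ?]. Qed.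

Lemma scalar_imB a b : scalar_im (a - b) = scalar_im a - scalar_im b.
Proof. by move: a b; rewrite /scalar_im; case: k => [? ?|[? ?] [? ?]]//; rewrite subrr. Qed.

Lemma ler_scalar_re a : `|scalar_re a| <= rnorm a.
Proof.
move: a; rewrite /rnorm /scalar_re; case: k => //= -[x y].
by rewrite -sqrtr_sqr ler_wsqrtr// lerDl sqr_ge0.
Qed.

Lemma ler_scalar_im a : `|scalar_im a| <= rnorm a.
Proof.
move: a; rewrite /rnorm /scalar_re /scalar_im; case: k => /= [x|[x y]].
  by rewrite normr0.
by rewrite -sqrtr_sqr ler_wsqrtr// lerDr sqr_ge0.
Qed.

Lemma rnorm_sub_mk a (x y : R) :
  rnorm (a - scalar_mk x y) <= `|scalar_re a - x| + `|scalar_im a - y|.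
Proof.
move: a; rewrite /rnorm /scalar_re /scalar_im /scalar_mk; case: k => /= [a|[a b]].
  by rewrite lerDl.
rewrite /Normc.normc/=; move: (a - x) (b - y) => p q.
rewrite -[leRHS]ger0_norm ?addr_ge0// -sqrtr_sqr ler_wsqrtr//.
rewrite sqrrD !real_normK ?num_real// lerD2r lerDl mulrn_wge0// mulr_ge0//.
Qed.

Lemma scalar_complete : cauchy_complete (K^o : normedModType K).
Proof.
move=> F FF /cauchy_rnormP cF.
have part (p : K -> R) : (forall a b, p (a - b) = p a - p b) ->
    (forall a, `|p a| <= rnorm a) -> exists x : R, p @ F --> x.
  move=> pB p_le; apply/cvg_ex; apply: cauchy_cvg; apply/cauchyP => e e0.
  have [a Fa] := cF e e0; exists (p a).
  apply: (filterS (F := F) _ Fa) => b /= ab.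
  by rewrite /ball/= -pB (le_lt_trans (p_le _)).
have [x Fx] := part _ scalar_reB ler_scalar_re.
have [y Fy] := part _ scalar_imB ler_scalar_im.
apply/cvg_ex; exists (scalar_mk x y); apply/cvg_rnormP => e e0.
have e20 : 0 < e / 2 by rewrite divr_gt0.
have /cvgrPdist_lt/(_ _ e20) Fx2 := Fx.
have /cvgrPdist_lt/(_ _ e20) Fy2 := Fy.
apply: filterS2 Fx2 Fy2 => a xa ya /=.
rewrite rnormB (le_lt_trans (rnorm_sub_mk _ _ _))// [e]splitr.
by rewrite ltrD// distrC.
Qed.

Lemma interval_net (C e : R) : 0 < e ->
  exists s : seq R, forall x, `|x| <= C -> exists2 y, y \in s & `|x - y| < e.
Proof.
move=> e0.
exists [seq e * i%:R - C | i <- iota 0 (Num.truncn ((C + C) / e)).+1] => x.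
rewrite ler_norml => /andP[Cx xC].
have xC0 : 0 <= (x + C) / e by rewrite divr_ge0 ?(ltW e0)//; lra.
have /andP[h1 h2] := truncn_itv xC0.
exists (e * (Num.truncn ((x + C) / e))%:R - C).
  apply/mapP; exists (Num.truncn ((x + C) / e)) => //.
  rewrite mem_iota/= add0n ltnS.
  by rewrite le_truncn// ler_pM2r ?invr_gt0//; lra.
move: h1 h2; rewrite ler_pdivlMr// ltr_pdivrMr// -natr1.
set t := _%:R => h1 h2; rewrite ltr_norml; apply/andP; split; nra.
Qed.

Lemma scalar_net (C e : R) : 0 < e ->
  exists s : seq K, forall a, rnorm a <= C -> exists2 b, b \in s & rnorm (a - b) < e.
Proof.
move=> e0; have [s sC] := interval_net C (divr_gt0 e0 (ltr0Sn R 1)).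
exists [seq scalar_mk x y | x <- s, y <- s] => a aC.
have [x xs ax] := sC _ (le_trans (ler_scalar_re a) aC).
have [y ys ay] := sC _ (le_trans (ler_scalar_im a) aC).
exists (scalar_mk x y); first exact: allpairs_f.
by rewrite (le_lt_trans (rnorm_sub_mk _ _ _))// [e]splitr ltrD.
Qed.

End Scalars.

(** * Total boundedness, and completeness of dual and Lipschitz spaces *)

Lemma subrACA (V : zmodType) (x y z t : V) : x - y - (z - t) = (x - z) - (y - t).
Proof. by rewrite opprD addrACA -opprD. Qed.

Section TotallyBounded.
Context (R : realType) (k : scalar_kind).
Local Notation K := (scalar_field R k).
Variable V : normedModType K.
Implicit Type A : set V.

Definition totally_bounded A := forall e : R, 0 < e ->
  exists s : seq V, forall a, A a -> exists2 b, b \in s & rnorm (a - b) < e.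

Lemma nbhs_rnorm (x : V) (e : R) : 0 < e -> nbhs x [set y | rnorm (x - y) < e].
Proof. by move=> e0; have /cvg_rnormP : nbhs x --> x by []; apply. Qed.

Lemma precompact_totally_bounded A : precompact A -> totally_bounded A.
Proof.
rewrite precompactE compact_cover => cA e e0.
have [| |D _ AD] := cA V setT (fun x => ball x (scalar_of e : K)).
- by move=> x _; exact: ball_open.
- by move=> x _; exists x => //; rewrite rnorm_ball subrr rnorm0.
exists (D : seq V) => a /subset_closure/AD[x /= Dx].
by rewrite rnorm_ball rnormB; exists x.
Qed.

Lemma ultra_finite_cover (F : set_system V) (s : seq V) (P : V -> set V) :
  UltraFilter F -> F [set y | exists2 b, b \in s & P b y] -> exists2 b, b \in s & F (P b).
Proof.
move=> FU; elim: s => [|b s IH] Fs.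
  by have [y [b]] := filter_ex Fs.
have [Fb|Fb] := in_ultra_setVsetC (P b) FU; first by exists b; rewrite ?mem_head.
have [|c cs Fc] := IH; last by exists c; rewrite // inE cs orbT.
apply: filterS2 Fs Fb => y [c]; rewrite inE => /orP[/eqP->//|cs Pc _].
by exists c.
Qed.

(** An ultrafilter on the closure of [A] contains one ball of each finite
    cover, hence is Cauchy. *)
Lemma totally_bounded_precompact A : cauchy_complete V -> totally_bounded A ->
  precompact A.
Proof.
move=> cV tA; rewrite precompactE compact_ultra => F FU FA.
have /cV/cvg_ex[p Fp] : cauchy F.
  apply/cauchy_rnormP => e e0; have e20 : 0 < e / 2 by rewrite divr_gt0.
  have [s As] := tA _ e20.
  suff [b _ Fb] : exists2 b, b \in s & F [set y | rnorm (b - y) < e] by exists b.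
  apply: ultra_finite_cover => //; apply: filterS FA => y /= Ay.
  have [a [Aa /= ya]] := Ay _ (nbhs_rnorm y e20).
  have [b bs ab] := As a Aa; exists b => //.
  by rewrite rnormB -(subrKA a) (le_lt_trans (rnormD _ _))// [e]splitr ltrD.
exists p; split=> //.
exact: (closed_cvg (F := F) (u_ := id) (closure A) (@closed_closure _ A) FA p Fp).
Qed.

Lemma rnorm_arbitrarily_small (v : V) (C : R) :
  (forall e : R, 0 < e -> rnorm v <= e * C) -> v = 0.
Proof.
move=> vC; apply: rnorm0_eq0; apply/eqP; rewrite eq_le rnorm_ge0 andbT.
apply/ler_addgt0Pr => d d0; rewrite add0r.
have C1 : 0 < 1 + `|C| by rewrite ltr_wpDr.
apply: le_trans (vC _ (divr_gt0 d0 C1)) _.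
rewrite -mulrA ger_pMr// mulrC ler_pdivrMr// mul1r.
by rewrite (le_trans (ler_norm _))// lerDr.
Qed.

End TotallyBounded.

Section DualComplete.
Context (R : realType) (k : scalar_kind).
Local Notation K := (scalar_field R k).
Variable E : normedModType K.

Definition dual_eval (e : E) (phi : top_dual E) : K^o := phi e.

Lemma dual_eval_linear e : linear (dual_eval e).
Proof. by move=> a phi psi; rewrite /dual_eval top_dualD top_dualZ. Qed.

HB.instance Definition _ e := GRing.isLinear.Build K (top_dual E) K^o _ (dual_eval e)
  (dual_eval_linear e).

Lemma top_dual_of_bounded (l : E -> K^o) (C : R) : linear l ->
  (forall e, rnorm (l e) <= C * rnorm e) -> exists phi : top_dual E, forall e, phi e = l e.
Proof.
move=> ll lC.
pose L : {linear E -> K^o} := HB.pack l (GRing.isLinear.Build K E K^o _ l ll).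
have cl : continuous L.
  apply: bounded_linear_continuous; apply/linear_boundedP.
  exists (scalar_of C); split; first by rewrite realE -(scalar_of0 R k) !ler_scalar_of le_total.
  move=> r Cr e; rewrite (le_trans _ (ler_wpM2r _ (ltW Cr)))//.
  by rewrite !rnormE -scalar_ofM ler_scalar_of.
have la : (l : E -> K^o) \in @alg_dual_pred K E by apply/asboolP.
have ld : (Submodule la : alg_dual E) \in @top_dual_pred R k E by apply/asboolP.
by exists (Submodule ld).
Qed.

Lemma top_dual_norm_le (phi : top_dual E) (C : R) : 0 <= C ->
  (forall e, rnorm (phi e) <= C * rnorm e) -> rnorm phi <= C.
Proof.
move=> C0 hC; rewrite rnorm_top_dual; apply: supnorm_le; first exact: unit_ball0.
by move=> e e1; rewrite (le_trans (hC e))// ler_piMr.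
Qed.

Lemma top_dual_complete : cauchy_complete (top_dual E).
Proof.
apply: (@complete_of_evaluations R k (top_dual E) K^o E
  (fun e => dual_eval e) (fun e => rnorm e)).
- exact: scalar_complete.
- exact: rnorm_ge0.
- by move=> e phi; rewrite rnorm_top_dual; exact: top_dual_normP.
- by move=> phi C; exact: top_dual_norm_le.
(* A limit [l] of functionals is linear because its defect of linearity is
   bounded by every multiple of a fixed constant. *)
move=> l lz.
have [z hz] := lz 1 ltr01.
apply: (@top_dual_of_bounded _ (1 + rnorm z)).
  move=> a u v; apply/eqP; rewrite -subr_eq0; apply/eqP.
  apply: (@rnorm_arbitrarily_small R k _ _
    (rnorm (a *: u + v) + (rnorm a * rnorm u + rnorm v))) => e /lz[w hw].
  have -> : l (a *: u + v) - (a *: l u + l v) =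
      (l (a *: u + v) - dual_eval (a *: u + v) w) -
      (a *: (l u - dual_eval u w) + (l v - dual_eval v w)).
    rewrite scalerBr [X in _ = _ - X]addrACA -opprD subrACA.
    by rewrite [dual_eval (_ + _) w](@alg_dual_linear K E (submodule_val w) a u v) subrr subr0.
  rewrite (le_trans (rnormD _ _))// rnormN mulrDr lerD ?hw//.
  rewrite (le_trans (rnormD _ _))// mulrDr lerD ?hw// rnormZ mulrCA.
  by rewrite ler_wpM2l ?rnorm_ge0// hw.
move=> e; rewrite -(subrK (dual_eval e z) (l e)) (le_trans (rnormD _ _))// mulrDl lerD//.
by rewrite rnorm_top_dual top_dual_normP.
Qed.

End DualComplete.

Section Lip0Complete.
Context (R : realType) (k : scalar_kind).
Local Notation K := (scalar_field R k).
Variables (X : metricType R) (x0 : X) (F : normedModType K).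

Definition lip_increment (p : X * X) (f : Lip0 x0 F) : F := f p.1 - f p.2.

Lemma lip_increment_linear p : linear (lip_increment p).
Proof.
move=> a f g; rewrite /lip_increment Lip0D Lip0Z !fctE/=.
by rewrite opprD addrACA -scalerBr.
Qed.

HB.instance Definition _ p := GRing.isLinear.Build K (Lip0 x0 F) F _ (lip_increment p)
  (lip_increment_linear p).

Lemma rnorm_Lip0P (f : Lip0 x0 F) x y : rnorm (f x - f y) <= rnorm f * mdist x y.
Proof. by rewrite rnorm_Lip; have [_] := Lip_constant f. Qed.

Lemma rnorm_Lip0_le (f : Lip0 x0 F) (C : R) : 0 <= C ->
  (forall x y, rnorm (f x - f y) <= C * mdist x y) -> rnorm f <= C.
Proof. by move=> C0 fC; rewrite rnorm_Lip; exact: Lip_le. Qed.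

Lemma Lip0_complete : cauchy_complete F -> cauchy_complete (Lip0 x0 F).
Proof.
move=> cF.
apply: (@complete_of_evaluations R k (Lip0 x0 F) F _
  (fun p => lip_increment p) (fun p => mdist p.1 p.2)) => //.
- by move=> p; exact: mdist_ge0.
- by move=> p f; exact: rnorm_Lip0P.
- by move=> f C C0 fC; apply: rnorm_Lip0_le => // x y; exact: (fC (x, y)).
(* A limit of increments is again a cocycle, hence the increment of the
   function [x |-> l (x, x0)]. *)
move=> l lz.
have lB x y : l (x, x0) - l (y, x0) = l (x, y).
  apply/eqP; rewrite -subr_eq0; apply/eqP.
  apply: (@rnorm_arbitrarily_small R k _ _ (mdist x x0 + mdist y x0 + mdist x y)) => e.
  move=> /lz[z hz].
  have -> : l (x, x0) - l (y, x0) - l (x, y) = (l (x, x0) - lip_increment (x, x0) z) -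
      (l (y, x0) - lip_increment (y, x0) z) - (l (x, y) - lip_increment (x, y) z).
    rewrite [X in _ = X - _]subrACA [RHS]subrACA /lip_increment/=.
    by rewrite (subrACA (Lip0_fun z x)) (subrr (Lip0_fun z x0)) subr0 subrr subr0.
  rewrite (le_trans (rnormD _ _))// rnormN mulrDr lerD ?hz//.
  by rewrite (le_trans (rnormD _ _))// rnormN mulrDr lerD ?hz.
have [z hz] := lz 1 ltr01.
have lf : (fun x => l (x, x0)) \in @lip0_pred R k X x0 F.
  apply/asboolP; split; first by rewrite -(lB x0 x0) subrr.
  exists (1 + rnorm z); split=> [|x y]; first by rewrite addr_ge0 ?rnorm_ge0.
  rewrite lB -(subrK (lip_increment (x, y) z) (l (x, y))) (le_trans (rnormD _ _))//.
  by rewrite mulrDl lerD ?rnorm_Lip0P//; exact: (hz (x, y)).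
by exists (Submodule lf) => -[x y]; exact: lB.
Qed.

End Lip0Complete.

(** * Recognizing a completion *)

Section IsometricCompletion.
Context (R : realType) (k : scalar_kind).
Local Notation K := (scalar_field R k).
Variables (V W : normedModType K) (J : {linear V -> W}).
Hypothesis J_isometry : forall v, rnorm (J v) = rnorm v.
Implicit Types (u : cauchy_seq V) (w : W).

Definition image_cvg u w := forall e : R, 0 < e ->
  exists N : nat, forall n, (N <= n)%N -> rnorm (J (u n) - w) < e.

Lemma image_cvg_linear (a : K) u1 u2 w1 w2 : image_cvg u1 w1 -> image_cvg u2 w2 ->
  image_cvg (a *: u1 + u2) (a *: w1 + w2).
Proof.
move=> uw1 uw2 e e0.
have a0 : 0 < 1 + rnorm a by rewrite ltr_wpDr ?rnorm_ge0.
have e20 : 0 < e / 2 by rewrite divr_gt0.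
have [N1 h1] := uw1 _ (divr_gt0 e20 a0); have [N2 h2] := uw2 _ e20.
exists (maxn N1 N2) => n; rewrite geq_max => /andP[Nn1 Nn2].
rewrite cauchy_seqD cauchy_seqZ !fctE/= linearP/= opprD addrACA -scalerBr.
rewrite (le_lt_trans (rnormD _ _))// [e]splitr ler_ltD ?h2//.
have := h1 _ Nn1; rewrite ltr_pdivlMr// => /ltW; apply: le_trans.
by rewrite rnormZ mulrC ler_wpM2l ?rnorm_ge0// lerDr.
Qed.

Lemma seq_norm_image_cvg u w : image_cvg u w -> seq_norm u = rnorm w.
Proof.
move=> uw; apply/cvg_lim => //; apply/cvgrPdist_lt => e /uw[N hN].
exists N => // n /= /hN; apply: le_lt_trans.
by rewrite -J_isometry (le_trans (rnorm_dist _ _))// rnormB.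
Qed.

Lemma cauchy_class_image_cvg u1 u2 w : image_cvg u1 w -> image_cvg u2 w ->
  cauchy_class u1 = cauchy_class u2.
Proof.
move=> uw1 uw2; apply/cauchy_class_eq; rewrite addrC -scaleN1r.
by rewrite (seq_norm_image_cvg (image_cvg_linear (-1) uw2 uw1)) scaleN1r addNr rnorm0.
Qed.

Lemma image_cvg_limit u : cauchy_complete W -> exists w, image_cvg u w.
Proof.
move=> /cauchy_seq_cvg; apply=> e /(cauchy_seqP u)[N hN].
by exists N => m n Nm Nn; rewrite -raddfB J_isometry hN.
Qed.

Hypothesis J_dense : forall w (e : R), 0 < e -> exists v, rnorm (w - J v) < e.

Lemma image_cvg_approx w : exists u, image_cvg u w.
Proof.
have /choice[v hv] : forall n : nat, exists v, rnorm (w - J v) < n.+1%:R^-1.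
  by move=> n; apply: J_dense; rewrite invr_gt0.
have close (d : R) : 0 < d -> exists N : nat, forall n, (N <= n)%N -> rnorm (w - J (v n)) < d.
  move=> d0; have [N _ hN] := near_infty_natSinv_lt (PosNum d0); exists N => n Nn.
  exact: lt_trans (hv n) (hN _ Nn).
have cv : v \in @cauchy_seq_pred R k V.
  apply/asboolP => e e0; have [|N hN] := close (e / 2); first by rewrite divr_gt0.
  exists N => m n Nm Nn; rewrite -J_isometry raddfB/= -(subrKA w).
  by rewrite (le_lt_trans (rnormD _ _))// [e]splitr ltrD ?hN// rnormB hN.
exists (Submodule cv) => e /close[N hN]; exists N => n Nn.
by rewrite rnormB hN.
Qed.

(** The isomorphism sends [w] to the class of any sequence whose image
    converges to [w]; completeness of [W] makes it surjective. *)
Lemma isometric_completion : cauchy_complete W ->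
  isometrically_isomorphic W (completion V).
Proof.
move=> cW.
have [U hU] := choice image_cvg_approx.
pose T w : completion V := cauchy_class (U w).
have T_linear : linear T.
  move=> a w1 w2; rewrite /T -cauchy_classZ -cauchy_classD.
  by apply: cauchy_class_image_cvg (hU _) _; exact: image_cvg_linear.
have T_isometry w : rnorm (T w) = rnorm w.
  by rewrite rnorm_completion completion_norm_class; exact: seq_norm_image_cvg.
pose LT : {linear W -> completion V} := HB.pack T (GRing.isLinear.Build K W _ _ T T_linear).
exists LT; split; last by move=> w; rewrite !rnormE [rnorm (LT w)]T_isometry.
have [S hS] := choice (fun q : completion V => image_cvg_limit (class_seq q) cW).
have TS q : LT (S q) = q.
  by rewrite -[RHS]class_seqK; exact: cauchy_class_image_cvg (hU _) (hS q).
exists S => // w; apply/eqP; rewrite -subr_eq0; apply/eqP/rnorm0_eq0.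
rewrite -T_isometry [T _](raddfB LT) [X in X - _](_ : _ = LT w) ?subrr ?rnorm0//.
exact: TS.
Qed.

End IsometricCompletion.

(** * Lipschitz compact maps *)

Section LipschitzCompact.
Context (R : realType) (k : scalar_kind).
Local Notation K := (scalar_field R k).
Variables (X : metricType R) (x0 : X) (F : normedModType K).
Implicit Types f g : Lip0 x0 F.

Definition diff_quotient (f : Lip0 x0 F) (x y : X) : F :=
  (scalar_of (mdist x y)^-1 : K) *: (f x - f y).

Lemma rnorm_diff_quotient f x y : rnorm (diff_quotient f x y) <= rnorm f.
Proof.
rewrite /diff_quotient rnormZ rnorm_scalar_of ?invr_ge0 ?mdist_ge0//.
have [->|d0] := eqVneq (mdist x y) 0; first by rewrite invr0 mul0r rnorm_ge0.
have dp : 0 < mdist x y by rewrite lt_neqAle eq_sym d0 mdist_ge0.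
by rewrite mulrC ler_pdivrMr// rnorm_Lip0P.
Qed.

Lemma diff_quotientB f g x y :
  diff_quotient (f - g : Lip0 x0 F) x y = diff_quotient f x y - diff_quotient g x y.
Proof.
rewrite /diff_quotient -scalerBr subrACA; congr (_ *: _).
Qed.

Lemma scale_diff_quotient f x y : (scalar_of (mdist x y) : K) *: diff_quotient f x y = f x - f y.
Proof.
have [d0|d0] := eqVneq (mdist x y) 0.
  by rewrite (mdist_positivity _ _ d0) subrr /diff_quotient subrr !scaler0.
by rewrite /diff_quotient scalerA -scalar_ofM divff// scalar_of1 scale1r.
Qed.

Lemma rnorm_LipK (f : LipK x0 F) : rnorm f = rnorm (submodule_val f).
Proof. by rewrite [LHS]scalar_ofK rnorm_Lip. Qed.

(** A uniform limit of totally bounded families of difference quotients is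
    totally bounded, and [F] is complete. *)
Lemma LipK_complete : cauchy_complete F -> cauchy_complete (LipK x0 F).
Proof.
move=> cF G GG /cauchy_rnormP cG.
have /cvg_ex[f /cvg_rnormP Gf] : cvg (@submodule_val _ _ _ @ G : set_system (Lip0 x0 F)).
  apply: Lip0_complete => //; apply/cauchy_rnormP => e /cG[g Gg].
  exists (submodule_val g); apply: (filterS (F := G) _ Gg) => h /=.
  by rewrite rnorm_LipK raddfB.
have fK : f \in @LipK_pred R k X x0 F.
  apply/asboolP/totally_bounded_precompact => // e e0.
  have e20 : 0 < e / 2 by rewrite divr_gt0.
  have [g /= fg] := filter_ex (F := G) (Gf _ e20).
  have /asboolP/precompact_totally_bounded/(_ _ e20)[s hs] := submoduleP g.
  exists s => _ [x [y [xy ->]]].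
  have [|b bs qb] := hs (diff_quotient (submodule_val g) x y); first by exists x, y.
  exists b => //; rewrite -/(diff_quotient f x y).
  rewrite -(subrKA (diff_quotient (submodule_val g) x y)) -diff_quotientB.
  rewrite (le_lt_trans (rnormD _ _))// [e]splitr ltrD//.
  exact: le_lt_trans (rnorm_diff_quotient _ _ _) _.
apply/cvg_ex; exists (Submodule fK); apply/cvg_rnormP => e e0.
apply: (filterS (F := G) _ (Gf _ e0)) => g /=.
by rewrite rnorm_LipK raddfB.
Qed.

End LipschitzCompact.

(** * Elements of the dual tensor space as Lipschitz compact maps *)

Section Representation.
Context (R : realType) (k : scalar_kind).
Local Notation K := (scalar_field R k).
Variables (X : metricType R) (x0 : X) (E : normedModType K).
Local Notation XE := (Lip0 x0 (top_dual E)).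
Local Notation CE := (circledast x0 E).
Local Notation LK := (LipK x0 (top_dual E)).
Implicit Types (f : LK) (v : CE) (g : Lip0 x0 K^o) (phi : top_dual E).

(** All the difference quotients lie in a bounded part of the line of [phi]. *)
Lemma lip_scale_compact g phi : lip_scale g phi \in @LipK_pred R k X x0 (top_dual E).
Proof.
apply/asboolP/totally_bounded_precompact; first exact: top_dual_complete.
move=> e e0; have phi1 : 0 < 1 + rnorm phi by rewrite ltr_wpDr ?rnorm_ge0.
have [s hs] := @scalar_net R k (rnorm g) _ (divr_gt0 e0 phi1).
exists [seq a *: phi | a <- s] => _ [x [y [xy ->]]].
have [b bs qb] := hs _ (rnorm_diff_quotient g x y).
exists (b *: phi); first exact: map_f.
rewrite [X in rnorm X](_ : _ = (diff_quotient g x y - b : K) *: phi); last first.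
  by rewrite scalerBl /diff_quotient -scalerA scalerBl.
move: qb; rewrite ltr_pdivlMr// rnormZ; apply: le_lt_trans.
by rewrite ler_wpM2l ?rnorm_ge0// lerDr.
Qed.

Definition lip_scaleK g phi : LK := Submodule (lip_scale_compact g phi).

Lemma boxtimes_in_span g phi :
  boxtimes g phi \in lin_span_pred [set v : alg_dual (tensor x0 E) |
    exists g phi, v = boxtimes g phi].
Proof. by apply: mem_lin_span; exists g, phi. Qed.

Definition circledast_boxtimes g phi : CE := Submodule (boxtimes_in_span g phi).

Definition represented_by v f := forall u : tensor x0 E,
  v u = alg_dual_fun (submodule_val u) (submodule_val f).

Lemma represented_by_boxtimes g phi : represented_by (circledast_boxtimes g phi) (lip_scaleK g phi).
Proof. by move=> u; exact: boxtimes_fun_val. Qed.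

Lemma represented_by_linear (a : K) v1 v2 f1 f2 :
  represented_by v1 f1 -> represented_by v2 f2 ->
  represented_by (a *: v1 + v2) (a *: f1 + f2).
Proof.
move=> vf1 vf2 u; rewrite circledastD circledastZ !fctE/= vf1 vf2.
by rewrite alg_dual_linear.
Qed.

Lemma represented_by0 : represented_by 0 0.
Proof. by move=> u; rewrite /circledast_fun !raddf0. Qed.

Lemma represented_by_sum (I : Type) (s : seq I) (a : I -> K) (v : I -> CE) (f : I -> LK) :
  (forall i, represented_by (v i) (f i)) ->
  represented_by (\sum_(i <- s) a i *: v i) (\sum_(i <- s) a i *: f i).
Proof.
move=> vf; elim/big_ind2 : _ => [|v1 f1 v2 f2 vf1 vf2|i _].
- exact: represented_by0.
- by rewrite -[v1]scale1r -[f1]scale1r; exact: represented_by_linear.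
rewrite -[_ *: v i]addr0 -[_ *: f i]addr0.
by apply: represented_by_linear => //; exact: represented_by0.
Qed.

Lemma represented_by_exists v : exists f, represented_by v f.
Proof.
have /asboolP[n [a [w [/= Aw vE]]]] := submoduleP v.
have /choice[t wt] : forall i, exists t : Lip0 x0 K^o * top_dual E, w i = boxtimes t.1 t.2.
  by move=> i; have [g [phi ->]] := Aw i; exists (g, phi).
exists (\sum_(i < n) a i *: lip_scaleK (t i).1 (t i).2).
have -> : v = \sum_(i < n) a i *: circledast_boxtimes (t i).1 (t i).2.
  apply: val_inj; rewrite [LHS]vE [RHS](raddf_sum (@submodule_val _ _ _))/=.
  by apply: eq_bigr => i _; rewrite wt.
by apply: represented_by_sum => i; exact: represented_by_boxtimes.
Qed.

Lemma delta_in_span x y e :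
  delta_boxtimes x0 x y e \in lin_span_pred [set u : alg_dual XE |
    exists x y e, u = delta_boxtimes x0 x y e].
Proof. by apply: mem_lin_span; exists x, y, e. Qed.

Definition tensor_delta x y e : tensor x0 E := Submodule (delta_in_span x y e).

Lemma represents_tensor_delta x y e : represents [:: (x, y, e)] (tensor_delta x y e).
Proof. by rewrite /represents big_seq1. Qed.

Lemma represented_by_delta v f x y e : represented_by v f ->
  v (tensor_delta x y e) =
  top_dual_fun (Lip0_fun (submodule_val f) x - Lip0_fun (submodule_val f) y) e.
Proof. by move=> ->. Qed.

(** The case of cost zero is separate: rescaling [u] to cost one is then
    impossible, and [v u = 0] comes from the boundedness of [v] alone. *)
Lemma proj_dual_norm_bound v r u : represents r u -> rnorm (v u) <= rnorm v * repr_cost r.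
Proof.
move=> ru; have [r0|r0] := eqVneq (repr_cost r) 0.
  by have [C _ /(_ _ _ ru)] := circledast_bound v; rewrite r0 !mulr0.
have rp : 0 < repr_cost r by rewrite lt_neqAle eq_sym r0 repr_cost_ge0.
pose t : K := scalar_of (repr_cost r)^-1.
have tE : rnorm t = (repr_cost r)^-1 by rewrite rnorm_scalar_of// invr_ge0 ltW.
have tu1 : proj_unit_ball (t *: u).
  rewrite /proj_unit_ball/= (le_trans (proj_norm_le (representsZ t ru)))//.
  by rewrite repr_cost_scale tE mulVf.
have := supnorm_ge (proj_unit_ball0 x0 E) (circledast_bounded_on v) tu1.
rewrite /circledast_fun linearZ/= rnormM tE mulrC ler_pdivrMr//.
by rewrite [rnorm v](scalar_ofK k).
Qed.

Lemma rnorm_apply_representation f r u : represents r u ->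
  rnorm (alg_dual_fun (submodule_val u) (submodule_val f)) <= rnorm f * repr_cost r.
Proof.
move=> ->; rewrite alg_dual_sum /repr_cost mulr_sumr.
elim/big_ind2 : _ => [|x1 x2 y1 y2 h1 h2|p _]; first by rewrite rnorm0.
  by rewrite (le_trans (rnormD _ _))// lerD.
rewrite (le_trans (top_dual_normP _ _))// mulrA ler_wpM2r ?rnorm_ge0//.
by rewrite -rnorm_top_dual rnorm_LipK rnorm_Lip0P.
Qed.

(** Costs of representations of [u] come arbitrarily close to [proj_norm u],
    which gives one inequality; the other needs only the tensors
    [tensor_delta x y e] with [e] in the unit ball. *)
Lemma represented_by_isometry v f : represented_by v f -> rnorm v = rnorm f.
Proof.
move=> vf; apply/eqP; rewrite eq_le; apply/andP; split.
  rewrite [leLHS](scalar_ofK k); apply: supnorm_le; first exact: proj_unit_ball0.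
  move=> u u1; rewrite vf; apply/ler_addgt0Pr => d d0.
  have f1 : 0 < 1 + rnorm f by rewrite ltr_wpDr ?rnorm_ge0.
  have [|r ru rc] := @proj_norm_lt _ _ _ _ _ u (1 + d / (1 + rnorm f)).
    by rewrite (le_lt_trans u1)// ltrDl divr_gt0.
  rewrite (le_trans (rnorm_apply_representation f ru))//.
  rewrite (le_trans (ler_wpM2l (rnorm_ge0 _) (ltW rc)))// mulrDr mulr1 lerD2l.
  rewrite mulrCA ger_pMr// ler_pdivrMr// mul1r lerDr//.
rewrite rnorm_LipK; apply: rnorm_Lip0_le => [|x y]; first exact: rnorm_ge0.
rewrite rnorm_top_dual; apply: supnorm_le; first exact: unit_ball0.
move=> e e1; rewrite -(represented_by_delta _ _ _ vf).
rewrite (le_trans (proj_dual_norm_bound _ (represents_tensor_delta x y e)))//.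
rewrite ler_wpM2l ?rnorm_ge0// /repr_cost big_seq1/=.
by rewrite ler_piMr// mdist_ge0.
Qed.

Lemma represented_by_unique v f1 f2 : represented_by v f1 -> represented_by v f2 -> f1 = f2.
Proof.
move=> vf1 vf2; apply/eqP; rewrite -subr_eq0; apply/eqP/rnorm0_eq0.
rewrite -(represented_by_isometry (v := 0)) ?rnorm0// -(subrr v) addrC -scaleN1r.
by rewrite -[f1 - _]addrC -[- f2]scaleN1r; exact: represented_by_linear.
Qed.

End Representation.

(** * Density of the represented maps *)

(** Interpolation nodes for a finite-dimensional space of functions, found one
    at a time: if the interpolant of [h] at the current nodes is not [h], then
    a point where the two differ is the next node.  For finite-rank operators
    this replaces a basis and its coordinate functionals by evaluations, which
    are continuous for the Lipschitz norm. *)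
Lemma finite_interpolation (K : numFieldType) (V : lmodType K) (I : Type)
    (ev : I -> {linear V -> K^o}) (s : seq V) :
  (forall v, (forall i, ev i v = 0) -> v = 0) ->
  exists r : seq (I * V), forall v, v \in lin_span_pred [set` s] ->
    v = \sum_(p <- r) (ev p.1 v : K) *: p.2.
Proof.
move=> sep.
suff [r rs] : exists r : seq (I * V), forall v, v \in s ->
    v = \sum_(p <- r) (ev p.1 v : K) *: p.2.
  exists r => v /asboolP[n [a [w [ws ->]]]].
  under [RHS]eq_bigr => p _ do rewrite linear_sum scaler_suml.
  rewrite exchange_big; apply: eq_bigr => i _ /=.
  rewrite {1}(rs (w i) (ws i)) scaler_sumr; apply: eq_bigr => p _.
  by rewrite [ev p.1 (_ *: _)]linearZ scalerA.
elim: s => [|h s [r IH]]; first by exists [::].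
pose P v := \sum_(p <- r) (ev p.1 v : K) *: p.2.
have [hP|/eqP hP] := eqVneq (h - P h) 0.
  exists r => v; rewrite inE => /orP[/eqP->|]; last exact: IH.
  by apply/eqP; rewrite -subr_eq0; apply/eqP.
have [i hi] : exists i, ev i (h - P h) != 0.
  apply: contrapT => ni; apply: hP; apply: sep => i.
  by have [//|hi] := eqVneq (ev i (h - P h)) 0; case: ni; exists i.
(* [g] is the interpolation error, normalized to take the value 1 at the new
   node; it corrects the older members so that the old interpolant is kept. *)
pose g := (ev i (h - P h) : K)^-1 *: (h - P h).
exists ((i, g) :: [seq (p.1, p.2 - (ev i p.2 : K) *: g) | p <- r]) => v vs.
rewrite big_cons big_map/=.
have -> : \sum_(p <- r) (ev p.1 v : K) *: (p.2 - (ev i p.2 : K) *: g) =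
    P v - (ev i (P v) : K) *: g.
  under eq_bigr do rewrite scalerBr.
  rewrite sumrB; congr (_ - _); rewrite linear_sum scaler_suml.
  by apply: eq_bigr => p _; rewrite [ev i (_ *: _)]linearZ scalerA.
rewrite addrC -addrA [- _ + _]addrC -scalerBl -[_ - _]raddfB.
move: vs; rewrite inE => /orP[/eqP->|/IH vs].
  by rewrite /g scalerA mulfV// scale1r addrC subrK.
by rewrite -/(P v) in vs; rewrite -vs subrr raddf0 scale0r addr0.
Qed.

Section JointNet.
Context (R : realType) (k : scalar_kind).
Local Notation K := (scalar_field R k).

(** Induction on [ds], for all [B] at once: cells where the first function is
    nearly constant are refined by the remaining functions.  The net is taken
    inside [B], since its members must have norm at most one when [B] is the
    unit ball. *)
Lemma joint_net (T D : eqType) (ev : D -> T -> K^o) (ds : seq D) (B : set T) (e : R) :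
  0 < e -> (forall d, d \in ds -> bounded_on B (ev d)) ->
  exists2 t : seq T, (forall x, x \in t -> B x) &
    forall x, B x -> exists2 y, y \in t & forall d, d \in ds -> rnorm (ev d x - ev d y) < e.
Proof.
move=> e0; elim: ds B => [|d ds IH] B Bb.
  have [[x Bx]|nB] := pselect (exists x, B x).
    by exists [:: x] => [y|y _]; [rewrite inE => /eqP->|exists x; rewrite ?mem_head].
  by exists [::] => // x Bx; case: nB; exists x.
have [C dC] := Bb d (mem_head _ _).
have e20 : 0 < e / 2 by rewrite divr_gt0.
have [s hs] := @scalar_net R k C _ e20.
have /choice[t ht] : forall c : K, exists t : seq T,
    (forall x, x \in t -> B x /\ rnorm (ev d x - c) < e / 2) /\
    forall x, B x -> rnorm (ev d x - c) < e / 2 ->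
      exists2 y, y \in t & forall d, d \in ds -> rnorm (ev d x - ev d y) < e.
  move=> c; have [|t tB ht] := IH [set x | B x /\ rnorm (ev d x - c) < e / 2].
    move=> d' ds'; have [|C' hC'] := Bb d'; first by rewrite inE ds' orbT.
    by exists C' => x [Bx _]; exact: hC'.
  by exists t; split=> [//|x Bx xc]; exact: ht.
exists (flatten [seq t c | c <- s]) => [x /flattenP[_ /mapP[c _ ->] xt]|x Bx].
  by have [/(_ _ xt)[]] := ht c.
have [c cs xc] := hs _ (dC x Bx).
have [tB /(_ x Bx xc)[y yt xy]] := ht c.
exists y; first by apply/flattenP; exists (t c) => //; exact: map_f.
move=> d'; rewrite inE => /orP[/eqP->|]; last exact: xy.
rewrite -(subrKA c) (le_lt_trans (rnormD _ _))// [e]splitr ltrD//.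
by have [_] := tB _ yt; rewrite rnormB.
Qed.

End JointNet.

Section Transpose.
Context (R : realType) (k : scalar_kind).
Local Notation K := (scalar_field R k).
Variables (X : metricType R) (x0 : X) (E : normedModType K).
Local Notation XE := (Lip0 x0 (top_dual E)).
Local Notation XK := (Lip0 x0 K^o).
Implicit Types f : XE.

Lemma top_dual_funB (phi psi : top_dual E) e :
  top_dual_fun (phi - psi) e = phi e - psi e.
Proof. exact: (raddfB (dual_eval e)). Qed.

Lemma Lip0B (F : normedModType K) (f g : Lip0 x0 F) x : Lip0_fun (f - g) x = f x - g x.
Proof. by rewrite /Lip0_fun raddfB. Qed.

Lemma transpose_in_Lip0 f e : (fun x => top_dual_fun (f x) e : K^o) \in @lip0_pred R k X x0 K^o.
Proof.
apply/asboolP; split; first by rewrite Lip0_base; exact: (raddf0 (dual_eval e)).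
exists (rnorm f * rnorm e); split=> [|x y]; first by rewrite mulr_ge0 ?rnorm_ge0.
rewrite -top_dual_funB (le_trans (top_dual_normP _ _))// mulrAC ler_wpM2r ?rnorm_ge0//.
by rewrite -rnorm_top_dual rnorm_Lip0P.
Qed.

Definition transpose f e : XK := Submodule (transpose_in_Lip0 f e).

Lemma transposeE f e x : Lip0_fun (transpose f e) x = top_dual_fun (Lip0_fun f x) e.
Proof. by []. Qed.

Lemma Lip0P (F : normedModType K) (f g : Lip0 x0 F) : (forall x, f x = g x) -> f = g.
Proof. by move=> fg; apply/val_inj/funext. Qed.

Lemma transpose_linear f : linear (transpose f).
Proof.
move=> a e e'; apply: Lip0P => x; rewrite Lip0D Lip0Z !fctE/=.
exact: alg_dual_linear.
Qed.

Lemma transposeB f g e : transpose (f - g) e = transpose f e - transpose g e.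
Proof.
apply: Lip0P => x; by rewrite transposeE !Lip0B top_dual_funB.
Qed.

Lemma rnorm_transpose f e : rnorm (transpose f e) <= rnorm f * rnorm e.
Proof.
apply: rnorm_Lip0_le => [|x y]; first by rewrite mulr_ge0 ?rnorm_ge0.
rewrite !transposeE -top_dual_funB (le_trans (top_dual_normP _ _))//.
by rewrite mulrAC ler_wpM2r ?rnorm_ge0// -rnorm_top_dual rnorm_Lip0P.
Qed.

Lemma rnorm_le_transpose f (C : R) :
  0 <= C -> (forall e, unit_ball e -> rnorm (transpose f e) <= C) -> rnorm f <= C.
Proof.
move=> C0 fC; apply: rnorm_Lip0_le => // x y.
rewrite rnorm_top_dual; apply: supnorm_le; first exact: unit_ball0.
move=> e e1; rewrite top_dual_funB -!transposeE (le_trans (rnorm_Lip0P _ _ _))//.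
by rewrite ler_wpM2r ?mdist_ge0// fC.
Qed.

(** Compactness passes to the transpose: a difference quotient [q] of [f] is
    within [e / 4] of some [phi] in a finite net, and a joint net for these
    functionals controls [phi u - phi v], so that [q u - q v] is at most
    three times [e / 4]. *)
Lemma transpose_totally_bounded (f : LipK x0 (top_dual E)) :
  totally_bounded [set transpose (submodule_val f) e | e in @unit_ball R k E].
Proof.
move=> e e0; have e40 : 0 < e / 4 by rewrite divr_gt0.
have /asboolP/precompact_totally_bounded/(_ _ e40)[s hs] := submoduleP f.
have [|t t1 ht] := @joint_net R k _ _ (@top_dual_fun R k E) s (@unit_ball R k E) _ e40.
  by move=> phi _; exact: top_dual_bounded_on.
exists [seq transpose (submodule_val f) u | u <- t] => _ [u u1 <-].
have [v vt uv] := ht u u1; exists (transpose (submodule_val f) v); first exact: map_f.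
apply: (@le_lt_trans _ _ (e / 4 + (e / 4 + e / 4))); last lra.
apply: rnorm_Lip0_le => [|x y]; first lra.
have [<-|xy] := eqVneq x y; first by rewrite subrr rnorm0 mulr_ge0 ?mdist_ge0//; lra.
have [q Dq fq] : exists2 q, difference_quotients (Lip0_fun (submodule_val f)) q &
    Lip0_fun (submodule_val f) x - Lip0_fun (submodule_val f) y =
    (scalar_of (mdist x y) : K) *: q.
  by exists (diff_quotient (submodule_val f) x y); [exists x, y|rewrite scale_diff_quotient].
have [phi phis qphi] := hs q Dq.
have qle w : unit_ball w -> rnorm (top_dual_fun q w - top_dual_fun phi w) <= e / 4.
  move=> w1; rewrite -top_dual_funB (le_trans (top_dual_normP _ _))//.
  by rewrite -rnorm_top_dual (le_trans _ (ltW qphi))// ler_piMr ?rnorm_ge0.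
have qu := qle u u1; have qv := qle v (t1 v vt); have uvphi := ltW (uv phi phis).
rewrite !Lip0B !transposeE subrACA -!top_dual_funB fq !top_dualZ -scalerBr rnormZ.
rewrite rnorm_scalar_of ?mdist_ge0// mulrC ler_wpM2r ?mdist_ge0//.
rewrite -(subrKA (top_dual_fun phi u)) (le_trans (rnormD _ _))// lerD//.
rewrite -(subrKA (top_dual_fun phi v)) (le_trans (rnormD _ _))// lerD//.
by rewrite rnormB.
Qed.

Lemma Lip0_point_separation (g : XK) :
  (forall x, lip_increment (x, x0) g = 0) -> g = 0.
Proof.
move=> g0; apply: Lip0P => x.
by have := g0 x; rewrite /lip_increment/= Lip0_base subr0.
Qed.

Lemma transposeD e : {morph transpose^~ e : f g / f + g}.
Proof.
by move=> f g; apply: Lip0P => x; rewrite transposeE !Lip0D; exact: top_dualD.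
Qed.

Lemma transpose0 e : transpose 0 e = 0.
Proof. by rewrite -[X in transpose X]subr0 transposeB subrr. Qed.

Lemma transpose_lip_scale (g : XK) (phi : top_dual E) e :
  transpose (lip_scale g phi) e = (phi e : K) *: g.
Proof.
apply: Lip0P => x; rewrite transposeE Lip0Z !fctE/=.
by rewrite [LHS]top_dualZ; exact: mulrC.
Qed.

(** The functionals [Phi x] are the composites of the transpose of [f], the
    finite-rank operator [T] and the evaluation at [x]. *)
Lemma represented_dense : approximation_property XK ->
  forall (f : LipK x0 (top_dual E)) (e : R), 0 < e ->
  exists v h, represented_by v h /\ rnorm (f - h) < e.
Proof.
move=> apX f e e0; set F := submodule_val f.
have cF : compact (closure [set transpose F u | u in @unit_ball R k E]).
  rewrite -precompactE; apply: totally_bounded_precompact (transpose_totally_bounded f).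
  by apply: Lip0_complete; exact: scalar_complete.
have e20 : 0 < e / 2 by rewrite divr_gt0.
have [T [[C TC] [s Ts] TF]] := apX _ _ cF e20.
have [r hr] := finite_interpolation (ev := fun x => lip_increment (x, x0)) s
  Lip0_point_separation.
have /choice[Phi hPhi] : forall x, exists phi : top_dual E,
    forall u, phi u = lip_increment (x, x0) (T (transpose F u)).
  move=> x; apply: (@top_dual_of_bounded _ _ _ _ (`|C| * rnorm F * mdist x x0)).
    by move=> a u w; rewrite transpose_linear (linearP T); exact: lip_increment_linear.
  move=> u; rewrite /lip_increment (le_trans (rnorm_Lip0P _ _ _))//= mulrAC.
  rewrite ler_wpM2r ?mdist_ge0// (le_trans (TC _))// -mulrA.
  rewrite (le_trans (ler_wpM2r (rnorm_ge0 _) (ler_norm C)))// ler_wpM2l//.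
  exact: rnorm_transpose.
pose h := \sum_(p <- r) (1 : K) *: lip_scaleK p.2 (Phi p.1).
exists (\sum_(p <- r) (1 : K) *: circledast_boxtimes p.2 (Phi p.1)), h; split.
  by apply: represented_by_sum => p; exact: represented_by_boxtimes.
have hT u : transpose (submodule_val h) u = T (transpose F u).
  rewrite (hr _ (Ts _)) [submodule_val h](raddf_sum (@submodule_val _ _ _))/=.
  rewrite (big_morph _ (transposeD u) (transpose0 u)).
  by apply: eq_bigr => p _; rewrite scale1r transpose_lip_scale hPhi.
rewrite (@le_lt_trans _ _ (e / 2))//; last by rewrite ltr_pdivrMr// ltr_pMr// ltr1n.
rewrite rnorm_LipK raddfB; apply: rnorm_le_transpose => [|u u1]; first exact: ltW.
rewrite transposeB hT rnormB ltW// TF//.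
by apply: subset_closure; exists u.
Qed.

End Transpose.

Theorem corollary8p3 (R : realType) (k : scalar_kind) (X : metricType R) (x0 : X)
    (hX : approximation_property (Lip0 x0 (scalar_field R k)^o))
    (E : completeNormedModType (scalar_field R k)) :
  isometrically_isomorphic (LipK x0 (top_dual E)) (completion (circledast x0 E)).
Proof.
have [J hJ] := choice (@represented_by_exists R k X x0 E).
have J_linear : linear J.
  move=> a v w; apply: represented_by_unique (hJ _) _.
  exact: represented_by_linear.
pose L : {linear circledast x0 E -> LipK x0 (top_dual E)} :=
  HB.pack J (GRing.isLinear.Build _ _ _ _ J J_linear).
apply: (@isometric_completion R k _ _ L).
- by move=> v; rewrite (represented_by_isometry (hJ v)).
- move=> f e e0; have [v [h [vh fh]]] := represented_dense hX f e0.
  by exists v; rewrite [L v](represented_by_unique (hJ v) vh).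
- by apply: LipK_complete; exact: top_dual_complete.
Qed.
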